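(* As an identity of formal power series in $q$, $$\sum_{\substack{r_1\geq r_2\geq r_3\geq 0\\ s_1\geq s_2\geq s_3\geq 0}} \frac{q^{r_1^2-r_1s_1+s_1^2+r_2^2-r_2s_2+s_2^2+r_3^2+r_3s_3+s_3^2+r_1+r_2+r_3+s_1+s_2+s_3}}{(q;q)_{r_1-r_2}(q;q)_{r_2-r_3}(q;q)_{r_3}(q;q)_{s_1-s_2}(q;q)_{s_2-s_3}(q;q)_{s_3}(q;q)_{r_3+s_3+1}} = \frac{1}{(q;q)_\infty}\,\frac{1}{\theta(q^{2},q^{3},q^{3},q^{4},q^{4},q^{5},q^{5};q^{11})},$$ where the sum runs over integers $r_1,r_2,r_3,s_1,s_2,s_3$ as indicated.
   Context: For an integer $L\ge 0$, $(a;q)_L:=(1-a)(1-aq)\cdots(1-aq^{L-1})$ and $(a;q)_\infty:=\lim_{L\to\infty}(a;q)_L$. The (modified) theta function is $\theta(a;q):=(a;q)_\infty(q/a;q)_\infty$, and $\theta(a_1,\dots,a_k;q):=\theta(a_1;q)\cdots\theta(a_k;q)$. In particular $\theta(q^i;q^{11})=(q^i;q^{11})_\infty(q^{11-i};q^{11})_\infty$. *)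

(* Defs.v *)
From HB Require Import structures.
From mathcomp Require Import all_boot all_order all_algebra finmap.
From mathcomp Require Import boolp classical_sets functions cardinality fsbigop.

Set Implicit Arguments.
Unset Strict Implicit.
Unset Printing Implicit Defensive.
Import GRing.Theory.
Local Open Scope ring_scope.
Local Open Scope classical_set_scope.

Record fps (R : Type) := Fps { fps_coef :> nat -> R }.

Lemma fpsP (R : Type) (f g : fps R) : f = g <-> (forall n, f n = g n).
Proof.
split=> [-> //|]; case: f g => [f] [g] /= fg.
by congr Fps; apply/funext.
Qed.

HB.instance Definition _ (R : Type) := gen_eqMixin (fps R).
HB.instance Definition _ (R : Type) := gen_choiceMixin (fps R).

Section FpsRing.
Variable R : comNzRingType.
Implicit Types f g h : fps R.

Definition fps_zero : fps R := Fps (fun=> 0).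
Definition fps_add f g := Fps (fun n => f n + g n).
Definition fps_opp f := Fps (fun n => - f n).
Definition fps_one : fps R := Fps (fun n => (n == 0%N)%:R).
Definition fps_mul f g := Fps (fun n => \sum_(i < n.+1) f i * g (n - i)%N).

Fact fps_addA : associative fps_add.
Proof. by move=> f g h; apply/fpsP => n /=; rewrite addrA. Qed.
Fact fps_addC : commutative fps_add.
Proof. by move=> f g; apply/fpsP => n /=; rewrite addrC. Qed.
Fact fps_add0 : left_id fps_zero fps_add.
Proof. by move=> f; apply/fpsP => n /=; rewrite add0r. Qed.
Fact fps_addN : left_inverse fps_zero fps_opp fps_add.
Proof. by move=> f; apply/fpsP => n /=; rewrite addNr. Qed.

HB.instance Definition _ :=
  GRing.isZmodule.Build (fps R) fps_addA fps_addC fps_add0 fps_addN.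

Definition fps_trunc f n : {poly R} := \poly_(i < n.+1) f i.

Lemma coef_fps_trunc f n i : (i <= n)%N -> (fps_trunc f n)`_i = f i.
Proof. by move=> le_in; rewrite coef_poly ltnS le_in. Qed.

Lemma coef_fps_trunc_mul f g n i : (i <= n)%N ->
  (fps_trunc f n * fps_trunc g n)`_i = fps_mul f g i.
Proof.
move=> le_in; rewrite coefM /=; apply: eq_bigr => j _.
rewrite !coef_fps_trunc ?(leq_trans (leq_subr _ _)) //.
by rewrite (leq_trans _ le_in) // -ltnS.
Qed.

Lemma fps_trunc_coef f n (p : {poly R}) :
  (forall i, (i <= n)%N -> p`_i = f i) ->
  forall g, (p * fps_trunc g n)`_n = fps_mul f g n.
Proof.
move=> pf g; rewrite coefM /=; apply: eq_bigr => j _.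
by rewrite pf ?coef_fps_trunc ?leq_subr //; case: j.
Qed.

Fact fps_mulC : commutative fps_mul.
Proof.
move=> f g; apply/fpsP => n.
by rewrite -!(@coef_fps_trunc_mul _ _ n) // mulrC.
Qed.

Fact fps_mulA : associative fps_mul.
Proof.
move=> f g h; apply/fpsP => n.
have fg_h := @fps_trunc_coef (fps_mul f g) n (fps_trunc f n * fps_trunc g n).
have gh_f := @fps_trunc_coef (fps_mul g h) n (fps_trunc g n * fps_trunc h n).
rewrite -fg_h => [|i]; last exact: coef_fps_trunc_mul.
rewrite fps_mulC -gh_f => [|i]; last exact: coef_fps_trunc_mul.
by rewrite mulrC mulrA.
Qed.

Fact fps_mul1 : left_id fps_one fps_mul.
Proof.
move=> f; apply/fpsP => n /=.
rewrite big_ord_recl /= mul1r subn0 big1 ?addr0 // => i _.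
by rewrite mul0r.
Qed.

Fact fps_mulDl : left_distributive fps_mul fps_add.
Proof.
move=> f g h; apply/fpsP => n /=; rewrite -big_split /=.
by apply: eq_bigr => i _; rewrite mulrDl.
Qed.

Fact fps_one_neq0 : fps_one != 0 :> fps R.
Proof. by apply/eqP => /fpsP /(_ 0%N) /eqP; rewrite /= oner_eq0. Qed.

HB.instance Definition _ := GRing.Zmodule_isComNzRing.Build (fps R)
  fps_mulA fps_mulC fps_mul1 fps_mulDl fps_one_neq0.

Lemma fps0E n : (0 : fps R) n = 0. Proof. by []. Qed.
Lemma fps1E n : (1 : fps R) n = (n == 0%N)%:R. Proof. by []. Qed.
Lemma fpsDE f g n : (f + g) n = f n + g n. Proof. by []. Qed.
Lemma fpsNE f n : (- f) n = - f n. Proof. by []. Qed.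
Lemma fpsBE f g n : (f - g) n = f n - g n. Proof. by []. Qed.
Lemma fpsME f g n : (f * g) n = \sum_(i < n.+1) f i * g (n - i)%N.
Proof. by []. Qed.
Lemma fpsM0E f g : (f * g) 0%N = f 0%N * g 0%N.
Proof. by rewrite fpsME big_ord1. Qed.

Definition fpsX : fps R := Fps (fun n => (n == 1%N)%:R).

Lemma fpsMXE f n : (fpsX * f) n = if n is m.+1 then f m else 0.
Proof.
rewrite fpsME big_ord_recl mul0r add0r; case: n => [|n]; first by rewrite big_ord0.
rewrite big_ord_recl /= mul1r subSS subn0 big1 ?addr0 // => i _.
by rewrite mul0r.
Qed.

Lemma fpsMXnE f k n : (fpsX ^+ k * f) n = if (n < k)%N then 0 else f (n - k)%N.
Proof.
elim: k n => [|k IHk] n; first by rewrite expr0 mul1r subn0.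
by rewrite exprS -mulrA fpsMXE; case: n => [|n] //; rewrite IHk ltnS subSS.
Qed.

Lemma fpsX_lreg k : GRing.lreg (fpsX ^+ k).
Proof.
move=> f g /fpsP fg; apply/fpsP => n; move: (fg (n + k)%N).
by rewrite !fpsMXnE ltnNge leq_addl /= addnK.
Qed.

Definition fps_unit : pred (fps R) := [pred f | `[< exists g, g * f = 1 >]].
Definition fps_inv f : fps R :=
  if f \in fps_unit then xget f [set g | g * f = 1] else f.

Fact fps_mulVr : {in fps_unit, left_inverse 1 fps_inv *%R}.
Proof.
move=> f fu; rewrite /fps_inv fu.
by move: fu => /asboolP fu; exact: (xgetPex (P := [set g | g * f = 1]) f fu).
Qed.
Fact fps_unitPl f g : g * f = 1 -> fps_unit f.
Proof. by move=> gf; apply/asboolP; exists g. Qed.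
Fact fps_inv_out : {in [predC fps_unit], fps_inv =1 id}.
Proof. by move=> f /negbTE fu; rewrite /fps_inv fu. Qed.

HB.instance Definition _ := GRing.ComNzRing_hasMulInverse.Build (fps R)
  fps_mulVr fps_unitPl fps_inv_out.

End FpsRing.
Arguments fpsX R : clear implicits.

Section FpsUnit.
Variable R : comUnitRingType.
Implicit Types f : fps R.

Fixpoint fps_inv_seq f n : seq R :=
  if n is m.+1 then
    let s := fps_inv_seq f m in
    rcons s (if m is 0 then (f 0%N)^-1
             else - (f 0%N)^-1 * \sum_(i < m) s`_i * f (m - i)%N)
  else [::].

Lemma size_fps_inv_seq f n : size (fps_inv_seq f n) = n.
Proof. by elim: n => //= n IHn; rewrite size_rcons IHn. Qed.

Lemma nth_fps_inv_seq f n i : (i < n)%N ->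
  (fps_inv_seq f n)`_i = (fps_inv_seq f i.+1)`_i.
Proof.
elim: n => // n IHn; rewrite ltnS leq_eqVlt => /orP[/eqP -> //|lt_in].
by rewrite -IHn // [LHS]nth_rcons size_fps_inv_seq lt_in.
Qed.

Lemma fps_unitE f : (f \is a GRing.unit) = (f 0%N \is a GRing.unit).
Proof.
apply/idP/idP => [fu | f0u].
  have /fpsP/(_ 0%N) := mulVr fu; rewrite fpsM0E => gf.
  by apply/unitrPr; exists (f^-1 0%N); rewrite mulrC gf.
pose g := Fps (fun n => (fps_inv_seq f n.+1)`_n).
suff gf : g * f = 1 by apply/unitrPr; exists g; rewrite mulrC.
apply/fpsP => n; rewrite fpsME big_ord_recr /= subnn.
rewrite nth_rcons size_fps_inv_seq ltnn eqxx.
case: n => [|n]; first by rewrite big_ord0 add0r mulVr.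
under eq_bigr => i _ do rewrite -[(rcons _ _)`_i]/((fps_inv_seq f i.+1)`_i)
  -(nth_fps_inv_seq f (ltn_ord i)).
by rewrite [X in _ + X]mulrAC mulNr mulVr // mulN1r subrr.
Qed.

End FpsUnit.

Section FpsConvergence.
Variable R : comNzRingType.
Implicit Types (u : nat -> fps R) (l a b q : fps R).

(* Convergence for the X-adic topology: each coefficient is eventually
   constant. *)
Definition fps_cvg u l :=
  forall n, exists N, forall m, (N <= m)%N -> u m n = l n.

(* The limit of u, or 0 if u diverges. *)
Definition fps_lim u : fps R := xget 0 [set l | fps_cvg u l].

Lemma fps_cvg_unique u l1 l2 : fps_cvg u l1 -> fps_cvg u l2 -> l1 = l2.
Proof.
move=> u1 u2; apply/fpsP => n.
have [N1 E1] := u1 n; have [N2 E2] := u2 n.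
by rewrite -(E1 _ (leq_maxl N1 N2)) -(E2 _ (leq_maxr N1 N2)).
Qed.

Lemma fps_cvg_lim u l : fps_cvg u l -> fps_lim u = l.
Proof.
by move=> ul; apply: xget_unique => // l' ul'; exact: fps_cvg_unique ul' ul.
Qed.

(* A family of power series is summable when each coefficient vanishes for all
   but finitely many indices; its sum is then computed coefficientwise. *)
Definition fps_summable (I : choiceType) (D : set I) (F : I -> fps R) :=
  forall n, finite_set [set i | D i /\ F i n != 0].

Definition fps_sum (I : choiceType) (D : set I) (F : I -> fps R) : fps R :=
  Fps (fun n => \sum_(i \in D) F i n).

Definition qpoch a q L : fps R := \prod_(k < L) (1 - a * q ^+ k).

Definition qpoch_inf a q : fps R := fps_lim (qpoch a q).

(* The exact quotient a / b, which may exist although b is not invertible, as in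
   fpsX ^+ 11 / fpsX ^+ 2; 0 if b does not divide a. *)
Definition fps_quot a b : fps R := xget 0 [set c | c * b = a].

Definition theta a q : fps R := qpoch_inf a q * qpoch_inf (fps_quot q a) q.

Definition thetas (s : seq (fps R)) q : fps R := \prod_(a <- s) theta a q.

Lemma qpochS a q L : qpoch a q L.+1 = qpoch a q L * (1 - a * q ^+ L).
Proof. exact: big_ord_recr. Qed.

Lemma fps_coef_mul_exp a q k n :
  q 0%N = 0 -> (n < k)%N -> (a * q ^+ k) n = 0.
Proof.
move=> q0; elim: k n a => // k IHk n a lt_nk.
rewrite exprSr mulrA fpsME big_ord_recr big1 => [|i _].
  by rewrite (subnn n) q0 mulr0; exact: addr0.
by rewrite IHk ?mul0r // (leq_trans (ltn_ord i)).
Qed.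

Lemma qpoch_cvg a q : q 0%N = 0 -> fps_cvg (qpoch a q) (qpoch_inf a q).
Proof.
move=> q0; pose l := Fps (fun n => qpoch a q n.+1 n).
suff cvl : fps_cvg (qpoch a q) l by rewrite /qpoch_inf (fps_cvg_lim cvl).
move=> n; exists n.+1 => m; elim: m => // m IHm.
rewrite leq_eqVlt => /predU1P[[<-] //|]; rewrite ltnS => lt_nm.
rewrite -[RHS]IHm // qpochS mulrBr mulr1 mulrA fpsBE.
by rewrite fps_coef_mul_exp // subr0.
Qed.

Lemma fps_quotXn i m : (i <= m)%N ->
  fps_quot (fpsX R ^+ m) (fpsX R ^+ i) = fpsX R ^+ (m - i).
Proof.
move=> le_im; apply: xget_unique => [|c] /=; first by rewrite -exprD subnK.
move=> cE; apply: (@fpsX_lreg _ i).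
by rewrite mulrC cE -exprD subnKC.
Qed.

Lemma theta_Xn i m : (i <= m)%N -> theta (fpsX R ^+ i) (fpsX R ^+ m) =
  qpoch_inf (fpsX R ^+ i) (fpsX R ^+ m)
  * qpoch_inf (fpsX R ^+ (m - i)) (fpsX R ^+ m).
Proof. by move=> le_im; rewrite /theta fps_quotXn. Qed.

End FpsConvergence.

(* Main.v *)
Require Import Defs.
From mathcomp Require Import all_boot all_order all_algebra finmap.
From mathcomp Require Import boolp classical_sets functions cardinality fsbigop.
From mathcomp Require Import zify ring.
Set Implicit Arguments.
Unset Strict Implicit.
Unset Printing Implicit Defensive.
Import Order.TTheory GRing.Theory Num.Theory.
Local Open Scope ring_scope.

(* The sum is an iterated A2 Bailey chain in the sense of Andrews, Schilling and
   Warnaar.  For a weight mu = (mu1, mu2, mu3) of the root lattice of A2, put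
     f_{r,s}(mu) = (q)_{r+s} / prod_i (q)_{r-mu_i} (q)_{s+mu_i}.
   Two applications of q-Chu-Vandermonde give the Bailey lemma
     sum_{r,s} q^(r^2-rs+s^2) f_{r,s}(mu) / ((q)_{A-r} (q)_{B-s})
       = q^(|mu|^2/2) f_{A,B}(mu).
   Starting from sum_mu alpha_2(mu) f_{r+1,s+1}(mu)
     = q^(2rs) / ((q)_r (q)_s (q)_{r+s+1}),
   three applications turn the left-hand side of the theorem into
   (q)_oo^-3 sum_mu alpha_11(mu), where alpha_N(mu) is, up to a sign, q to the
   N(|mu|^2-2)/6 - (rho, mu) + 2, supported on the Weyl orbit of rho modulo three
   times the root lattice.  This last sum is the A2 Macdonald identity for the
   modulus 11; it follows from the Jacobi triple product by summing
   theta(x) theta(y) theta(xy) along the lines of Z^3 on which the exponents of x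
   and y are constant, each line contributing a pentagonal number series.  The initial
   identity, for q replaced by 1/q, is the constant term of a finite product
   against the A2 Macdonald denominator, whose antisymmetry and quasi-periodicity
   yield a two-term recurrence. *)

(** * q-binomial coefficients *)

Section QBinomial.
Variable R : comNzRingType.
Implicit Type q : R.

Definition qfact q n : R := \prod_(k < n) (1 - q ^+ k.+1).

Fixpoint qbinom q n k : R :=
  match n, k with
  | _, 0%N => 1
  | 0%N, _.+1 => 0
  | n'.+1, k'.+1 => qbinom q n' k' + q ^+ k * qbinom q n' k
  end.

Lemma qfactS q n : qfact q n.+1 = qfact q n * (1 - q ^+ n.+1).
Proof. by rewrite /qfact big_ord_recr. Qed.

Lemma qfact0 q : qfact q 0 = 1.
Proof. by rewrite /qfact big_ord0. Qed.

Lemma qbinom0 q n : qbinom q n 0 = 1.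
Proof. by case: n. Qed.

Lemma qbinomS q n k :
  qbinom q n.+1 k.+1 = qbinom q n k + q ^+ k.+1 * qbinom q n k.+1.
Proof. by []. Qed.

Lemma qbinom_small q n k : (n < k)%N -> qbinom q n k = 0.
Proof.
elim: n k => [|n IHn] [|k] //; rewrite ltnS => lt_nk.
by rewrite qbinomS !IHn ?mulr0 ?addr0 //; exact: ltnW.
Qed.

Lemma qbinomn q n : qbinom q n n = 1.
Proof.
by elim: n => // n IHn; rewrite qbinomS IHn qbinom_small // mulr0 addr0.
Qed.

(** The factorial formula without division, valid in every commutative ring. The induction splits 1
    - q^(k+n+2) as (1 - q^(k+1)) + q^(k+1) (1 - q^(n+1)). *)
Lemma qbinom_qfactD q n k :
  qbinom q (k + n) k * qfact q k * qfact q n = qfact q (k + n).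
Proof.
elim: k n => [|k IHk] n; first by rewrite qbinom0 qfact0 !mul1r.
elim: n => [|n IHn]; first by rewrite addn0 qbinomn qfact0 mul1r mulr1.
have E1 := IHk n.+1; rewrite addnS in E1.
rewrite !addSn addnS in IHn *.
have E2 : q ^+ (k + n).+2 = q ^+ k.+1 * q ^+ n.+1 by rewrite -exprD addnS.
rewrite qbinomS (qfactS q (k + n).+1) E2.
transitivity (qfact q (k + n).+1 * (1 - q ^+ k.+1)
  + qfact q (k + n).+1 * (q ^+ k.+1 * (1 - q ^+ n.+1))); last by ring.
by rewrite -{1}E1 -IHn !qfactS; ring.
Qed.

End QBinomial.

Lemma rmorph_qbinom (R S : comNzRingType) (h : {rmorphism R -> S}) (q : R) n k :
  h (qbinom q n k) = qbinom (h q) n k.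
Proof.
elim: n k => [|n IHn] [|k] /=; rewrite ?rmorph1 ?rmorph0 //.
by rewrite rmorphD rmorphM rmorphXn !IHn.
Qed.

(** * Constant terms against the Macdonald denominator *)

(* Coordinates on the root lattice of A2: mu = (x, y, - x - y).  When mu is
   congruent to w(rho) modulo 3, with w in S3, [chi3 (x - y)] is the sign of w and
   [wt x y] is (|mu|^2 - 2) / 6; otherwise [chi3 (x - y)] is 0. *)
Definition chi3 (d : int) : int :=
  if (d %% 3)%Z == 1 then 1 else if (d %% 3)%Z == 2 then -1 else 0.

Definition wt (x y : int) : int := (((x - y) ^+ 2 - 1) %/ 3)%Z + x * y.

Lemma chi3N d : chi3 (- d) = - chi3 d.
Proof.
rewrite /chi3; do !case: ifP; lia.
Qed.

Lemma chi3_shift d d' k : d' = d + k * 3 -> chi3 d' = chi3 d.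
Proof. by move=> ->; rewrite /chi3 addrC modzMDl. Qed.

Lemma divz_shift (a b k : int) : a = b + k * 3 -> (a %/ 3)%Z = (b %/ 3)%Z + k.
Proof. by move=> ->; rewrite addrC divzMDl // addrC. Qed.

Section Alternant.
Variables (F : fieldType) (q : F).
Implicit Types (phi : nat -> F) (p r : {poly F}).

(** The linear functional sending X^i to [phi i]. Iterated, it yields constant terms in three
    variables without Laurent polynomials. *)
Definition ev (phi : nat -> F) (p : {poly F}) : F :=
  \sum_(i < size p) p`_i * phi i.

Lemma ev_widen phi p N : (size p <= N)%N -> ev phi p = \sum_(i < N) p`_i * phi i.
Proof.
move=> sp; rewrite /ev (big_ord_widen N (fun i => p`_i * phi i) sp).
rewrite big_mkcond; apply: eq_bigr => i _; case: ltnP => // le_pi.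
by rewrite nth_default // mul0r.
Qed.

Lemma eq_ev phi psi p : phi =1 psi -> ev phi p = ev psi p.
Proof. by move=> e; apply: eq_bigr => i _; rewrite e. Qed.

Lemma evD phi p r : ev phi (p + r) = ev phi p + ev phi r.
Proof.
pose N := maxn (size p) (size r).
rewrite (@ev_widen _ _ N) ?size_polyD // (@ev_widen _ p N) ?leq_maxl //.
rewrite (@ev_widen _ r N) ?leq_maxr // -big_split /=.
by apply: eq_bigr => i _; rewrite coefD mulrDl.
Qed.

Lemma evZ phi c p : ev phi (c *: p) = c * ev phi p.
Proof.
rewrite (@ev_widen _ _ (size p)) ?size_scale_leq // mulr_sumr.
by apply: eq_bigr => i _; rewrite coefZ mulrA.
Qed.

Lemma ev_mull phi c p : ev (fun i => c * phi i) p = c * ev phi p.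
Proof. by rewrite mulr_sumr; apply: eq_bigr => i _; rewrite mulrCA. Qed.

Lemma ev_mulX phi p : ev phi ('X * p) = ev (phi \o S) p.
Proof.
rewrite (@ev_widen _ _ (size p).+1); last first.
  by rewrite mulrC (leq_trans (size_polyMleq _ _)) // size_polyX addn2.
rewrite big_ord_recl coefXM mul0r add0r.
by apply: eq_bigr => i _; rewrite coefXM.
Qed.

Lemma ev_exchange (phi : nat -> nat -> F) p r :
  ev (fun i => ev (phi i) r) p = ev (fun j => ev (phi^~ j) p) r.
Proof.
rewrite /ev; under eq_bigr do rewrite mulr_sumr.
rewrite exchange_big; apply: eq_bigr => j _; rewrite mulr_sumr.
by apply: eq_bigr => i _; rewrite mulrCA.
Qed.

Definition dil (c : F) (p : {poly F}) : {poly F} := p \Po (c *: 'X).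

Lemma coef_dil c p i : (dil c p)`_i = c ^+ i * p`_i.
Proof.
rewrite /dil comp_polyE coef_sum.
under eq_bigr => j _ do rewrite exprZn !coefZ coefXn.
have [lt_ip|le_pi] := ltnP i (size p).
  rewrite (bigD1 (Ordinal lt_ip)) //= eqxx mulr1 big1 ?addr0 1?mulrC // => j.
  by rewrite -val_eqE /= eq_sym => /negbTE ->; rewrite !mulr0.
rewrite nth_default // mulr0 big1 // => j _.
by rewrite gtn_eqF ?mulr0 // (leq_trans (ltn_ord j)).
Qed.

Lemma ev_dil phi c p : ev phi (dil c p) = ev (fun i => c ^+ i * phi i) p.
Proof.
rewrite (@ev_widen _ _ (size p)); last first.
  by apply/leq_sizeP => j le_pj; rewrite coef_dil nth_default ?mulr0.
by apply: eq_bigr => i _; rewrite coef_dil mulrCA mulrA.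
Qed.

(* The coefficient of z1^a z2^b z3^c in the Macdonald denominator
   z1 / z3 * (q)_oo^2 * theta(z2/z1) theta(z3/z2) theta(z3/z1). *)
Definition macdonald (a b c : int) : F :=
  if a + b + c == 0 then (chi3 (a - b))%:~R * q ^ wt a b else 0.

Lemma macdonald_swap12 a b c : macdonald b a c = - macdonald a b c.
Proof.
rewrite /macdonald (addrC b a); case: eqP => _; last by rewrite oppr0.
rewrite -[b - a]opprB chi3N rmorphN mulNr /wt (mulrC b a).
by rewrite -(sqrrN (b - a)) opprB.
Qed.

(** On the support c = - a - b, so a - c = 2a + b is congruent to - (a - b) modulo 3. *)
Lemma macdonald_swap23 a b c : macdonald a c b = - macdonald a b c.
Proof.
rewrite /macdonald addrAC; case: eqP => [E|_]; last by rewrite oppr0.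
have -> : c = - a - b by lia.
have -> : chi3 (a - (- a - b)) = - chi3 (a - b).
  by rewrite -chi3N; apply: (chi3_shift (k := a)); ring.
rewrite rmorphN mulNr; congr (- (_ * q ^ _)).
rewrite /wt (@divz_shift ((a - (- a - b)) ^+ 2 - 1) ((a - b) ^+ 2 - 1) (a ^+ 2 + 2 * a * b)); ring.
Qed.

(* Up to sign, the constant term of p1(z1) p2(z2) p3(z3) / (z1 z2 z3)^n against
   the Macdonald denominator. *)
Definition Lam (n : int) (p1 p2 p3 : {poly F}) : F :=
  ev (fun i => ev (fun j => ev (fun k => macdonald (i%:Z - n) (j%:Z - n) (k%:Z - n))
    p3) p2) p1.

Lemma evN phi p : ev (fun i => - phi i) p = - ev phi p.
Proof. by rewrite -sumrN; apply: eq_bigr => i _; rewrite mulrN. Qed.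

Lemma Lam_swap12 n p1 p2 p3 : Lam n p2 p1 p3 = - Lam n p1 p2 p3.
Proof.
rewrite /Lam ev_exchange -evN; apply: eq_ev => i; rewrite -evN; apply: eq_ev => j.
by rewrite -evN; apply: eq_ev => k; rewrite macdonald_swap12.
Qed.

Lemma Lam_swap23 n p1 p2 p3 : Lam n p1 p3 p2 = - Lam n p1 p2 p3.
Proof.
rewrite /Lam -evN; apply: eq_ev => i; rewrite ev_exchange -evN; apply: eq_ev => j.
by rewrite -evN; apply: eq_ev => k; rewrite macdonald_swap23.
Qed.

Lemma Lam_cyc n p1 p2 p3 : Lam n p3 p1 p2 = Lam n p1 p2 p3.
Proof. by rewrite Lam_swap12 Lam_swap23 opprK. Qed.

Lemma Lam_sum N n p1 p2 p3 :
  (size p1 <= N)%N -> (size p2 <= N)%N -> (size p3 <= N)%N ->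
  Lam n p1 p2 p3 = \sum_(i < N) \sum_(j < N) \sum_(k < N)
    p1`_i * p2`_j * p3`_k * macdonald (i%:Z - n) (j%:Z - n) (k%:Z - n).
Proof.
move=> s1 s2 s3; rewrite /Lam (ev_widen _ s1); apply: eq_bigr => i _.
rewrite (ev_widen _ s2) mulr_sumr; apply: eq_bigr => j _.
rewrite (ev_widen _ s3) !mulr_sumr; apply: eq_bigr => k _.
by rewrite !mulrA.
Qed.

Lemma LamD n p p' p2 p3 : Lam n (p + p') p2 p3 = Lam n p p2 p3 + Lam n p' p2 p3.
Proof. exact: evD. Qed.

Lemma LamZ n c p p2 p3 : Lam n (c *: p) p2 p3 = c * Lam n p p2 p3.
Proof. exact: evZ. Qed.

Lemma LamMX n p1 p2 p3 :
  Lam (n + 1) ('X * p1) ('X * p2) ('X * p3) = Lam n p1 p2 p3.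
Proof.
rewrite /Lam ev_mulX; apply: eq_ev => i /=; rewrite ev_mulX; apply: eq_ev => j /=.
rewrite ev_mulX; apply: eq_ev => k /=.
by congr macdonald; lia.
Qed.

Hypothesis q_neq0 : q != 0.

(* Quasi-periodicity of the denominator under z1 -> q z1. *)
Lemma macdonald_rot a b c : macdonald a b c = q ^ (a - 1) * macdonald (a - 2) (b + 1) (c + 1).
Proof.
rewrite /macdonald; have -> : a - 2 + (b + 1) + (c + 1) = a + b + c by ring.
case: eqP => _; last by rewrite mulr0.
have -> : chi3 (a - 2 - (b + 1)) = chi3 (a - b).
  by apply: (chi3_shift (k := -1)); ring.
rewrite mulrCA; congr (_ * _); rewrite -expfzDr //; congr (_ ^ _).
rewrite /wt (@divz_shift ((a - 2 - (b + 1)) ^+ 2 - 1) ((a - b) ^+ 2 - 1) (3 - 2 * (a - b))); ring.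
Qed.

(** Quasi-periodicity shifts (a, b, c) by (-2, 1, 1): lowering n by 1 gives (1, 1, 1), and removing
    X^3 from the first argument gives (-3, 0, 0). The factor q^(a - 1) becomes the dilation of [p1]
    and the power of q in front. *)
Lemma Lam_rot n p1 p2 p3 :
  Lam n ('X^3 * p1) p2 p3 = q ^ (2 - n) * Lam (n - 1) (dil q p1) p2 p3.
Proof.
rewrite /Lam !exprS expr0 mulr1 -!mulrA !ev_mulX ev_dil -ev_mull.
apply: eq_ev => i /=; rewrite mulrA -ev_mull; apply: eq_ev => j.
rewrite -ev_mull; apply: eq_ev => k; rewrite macdonald_rot; congr (_ * _); last first.
  by congr macdonald; lia.
rewrite exprnP -expfzDr //; congr (_ ^ _); lia.
Qed.

(** The denominator is homogeneous of degree 0, so only exponents with i + j + k = 3n contribute. *)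
Lemma Lam_dil n p1 p2 p3 :
  Lam n (dil q p1) (dil q p2) (dil q p3) = q ^ (n * 3) * Lam n p1 p2 p3.
Proof.
rewrite /Lam ev_dil -ev_mull; apply: eq_ev => i.
rewrite ev_dil -!ev_mull; apply: eq_ev => j.
rewrite ev_dil -!ev_mull; apply: eq_ev => k.
rewrite /macdonald; case: eqP => E; last by rewrite !mulr0.
rewrite !mulrA !exprnP -!expfzDr //; congr (q ^ _ * _ * _); lia.
Qed.

End Alternant.

(** * Values of the alternating form at products of linear factors *)

Section AlternantProduct.
Variables (F : fieldType) (q : F).
Hypotheses (q_neq0 : q != 0) (two_neq0 : 2%:R != 0 :> F).
Implicit Types p r : {poly F}.
Local Notation Lam := (Lam q).

Lemma LamD2 n p1 p p' p3 : Lam n p1 (p + p') p3 = Lam n p1 p p3 + Lam n p1 p' p3.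
Proof. by rewrite Lam_swap12 LamD opprD -!Lam_swap12. Qed.

Lemma LamD3 n p1 p2 p p' : Lam n p1 p2 (p + p') = Lam n p1 p2 p + Lam n p1 p2 p'.
Proof. by rewrite Lam_swap23 LamD2 opprD -!Lam_swap23. Qed.

Lemma LamZ2 n c p1 p p3 : Lam n p1 (c *: p) p3 = c * Lam n p1 p p3.
Proof. by rewrite Lam_swap12 LamZ -mulrN -Lam_swap12. Qed.

Lemma LamZ3 n c p1 p2 p : Lam n p1 p2 (c *: p) = c * Lam n p1 p2 p.
Proof. by rewrite Lam_swap23 LamZ2 -mulrN -Lam_swap23. Qed.

Lemma eq_opp_eq0 (x : F) : x = - x -> x = 0.
Proof.
move/eqP; rewrite -addr_eq0 -mulr2n -mulr_natl mulf_eq0 (negPf two_neq0) /=.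
by move/eqP.
Qed.

Lemma Lam_alt12 n p r : Lam n p p r = 0.
Proof. by apply: eq_opp_eq0; rewrite -Lam_swap12. Qed.

Lemma Lam_alt23 n p r : Lam n r p p = 0.
Proof. by apply: eq_opp_eq0; rewrite -Lam_swap23. Qed.

Lemma Lam_alt13 n p r : Lam n p r p = 0.
Proof. by rewrite Lam_swap12 Lam_alt23 oppr0. Qed.

(** After rotation the first and third arguments are both [dil q p]. *)
Lemma Lam_wall n p r : Lam n ('X^3 * p) r (dil q p) = 0.
Proof. by rewrite Lam_rot // Lam_alt13 mulr0. Qed.

Lemma dil_mulXn c p : dil q ('X^c * p) = q ^+ c *: ('X^c * dil q p).
Proof.
by rewrite /dil rmorphM rmorphXn /= comp_polyX exprZn scalerAl.
Qed.

(** The rotation read backwards: cyclic symmetry moves the third variable to the front, and its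
    dilation is traded for a factor X^3. *)
Lemma Lam_rot3 n p1 p2 p c :
  Lam n p1 p2 ('X^c * dil q p)
  = q ^ (n - 1 - c%:Z) * Lam (n + 1) ('X^(c.+3) * p) p1 p2.
Proof.
rewrite (_ : 'X^(c.+3) * p = 'X^3 * ('X^c * p)); last by rewrite mulrA -exprD.
rewrite Lam_rot // dil_mulXn LamZ addrK (exprnP q c) !mulrA -!expfzDr //.
rewrite (_ : n - 1 - c%:Z + (2 - (n + 1)) + c%:Z = 0); last by lia.
rewrite expr0z mul1r; exact/esym/Lam_cyc.
Qed.

Definition qprod m : {poly F} := \prod_(k < m) (1 + q ^+ k *: 'X).

Lemma qprodS m : qprod m.+1 = qprod m * (1 + q ^+ m *: 'X).
Proof. by rewrite /qprod big_ord_recr. Qed.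

Lemma qprodSl m : qprod m.+1 = (1 + 'X) * dil q (qprod m).
Proof.
rewrite /qprod big_ord_recl scale1r /dil rmorph_prod; congr (_ * _).
apply: eq_bigr => i _; rewrite rmorphD rmorph1 /= comp_polyZ comp_polyX scalerA.
by rewrite -exprSr.
Qed.

Lemma coef_qprod m j : (qprod m)`_j = q ^+ 'C(j, 2) * qbinom q m j.
Proof.
elim: m j => [|m IHm] j.
  by rewrite /qprod big_ord0 coefC; case: j => [|j]; rewrite ?mulr1 ?mulr0.
rewrite qprodSl mulrDl mul1r coefD coefXM !coef_dil !IHm.
case: j => [|j]; first by rewrite qbinom0 addr0 !mul1r.
by rewrite binS bin1 qbinomS exprD /=; ring.
Qed.

(** The exponents 2, 1, 0 are the least for which an alternating form need not vanish on the same
    product times three powers of X. *)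
Definition Lam_staircase m n := Lam n ('X^2 * qprod m) ('X^1 * qprod m) ('X^0 * qprod m).

(* Writing (r s t) for the value of [Lam] at z1^r z2^s z3^t times the product of
   length m, we expand the product of length m + 1 in two ways: by removing the
   last factor from all three variables, or the first factor from z3 only.  Each
   is a combination of (2 1 0), (3 1 0), (3 2 0) and (3 2 1), and the last three
   cancel in a suitable difference of the two. *)
Lemma Lam_staircase_rec m n :
  (1 - q ^ (2 - n + m%:Z)) * Lam_staircase m.+1 n = (1 - q ^+ m.+1) * Lam_staircase m n.
Proof.
set t := q ^+ m; pose P := qprod m.
pose L i j k := Lam n ('X^i * P) ('X^j * P) ('X^k * P).
have XP i : 'X^i * qprod m.+1 = 'X^i * P + t *: ('X^(i.+1) * P).
  by rewrite qprodS -/P -!mul_polyC exprS; ring.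
have E1 : Lam_staircase m.+1 n = L 2 1 0 + t * L 3 1 0 + t ^+ 2 * L 3 2 0 + t ^+ 3 * L 3 2 1.
  rewrite /Lam_staircase !XP !(LamD, LamZ, LamD2, LamZ2, LamD3, LamZ3).
  rewrite !(Lam_alt12, Lam_alt23) -/(L _ _ _) /L; ring.
have XS i : 'X^(i.+1) * P = 'X * ('X^i * P) by rewrite exprS mulrA.
have R3 i j c : Lam n ('X^(i.+1) * P) ('X^(j.+1) * P) ('X^c * dil q P)
    = q ^ (n - 1 - c%:Z) * L c.+2 i j.
  by rewrite Lam_rot3 (XS c.+2) (XS i) (XS j) LamMX.
have E3 : Lam_staircase m.+1 n = q ^ (n - 1) * L 2 1 0
    + q ^ (n - 2) * (L 3 1 0 + t * L 3 2 0 + t ^+ 2 * L 3 2 1).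
  have XE : 'X^0 * qprod m.+1 = 'X^0 * dil q P + 'X^1 * dil q P.
    by rewrite qprodSl expr0 expr1 !mul1r mulrDl mul1r.
  rewrite /Lam_staircase XE !XP !(LamD, LamZ, LamD2, LamZ2, LamD3, LamZ3).
  have W r : Lam n ('X^3 * P) r ('X^0 * dil q P) = 0.
    by rewrite expr0 mul1r Lam_wall.
  rewrite !W !Lam_alt12 !R3 subr0 (_ : n - 1 - 1 = n - 2); last by lia.
  ring.
(* Multiplied by q^(2-n) t, the second expansion agrees with the first in its last three terms. *)
have ba : q ^ (2 - n) * q ^ (n - 2) = 1.
  by rewrite -expfzDr // (_ : 2 - n + (n - 2) = 0) ?expr0z //; lia.
rewrite expfzDr // -exprnP -/t exprS -/t mulrBl mul1r {1}E1 E3.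
have -> : q ^ (n - 1) = q ^ (n - 2) * q.
  by rewrite -[X in _ * X]expr1z -expfzDr //; congr (_ ^ _); lia.
rewrite (_ : q ^ (2 - n) * t * _ = q ^ (2 - n) * q ^ (n - 2)
  * (t * (q * L 2 1 0 + L 3 1 0 + t * L 3 2 0 + t ^+ 2 * L 3 2 1))); last by ring.
rewrite ba /Lam_staircase -/P -/(L 2 1 0); ring.
Qed.

Lemma size_qprod m : (size (qprod m) <= m.+1)%N.
Proof. by apply/leq_sizeP => j lt_mj; rewrite coef_qprod qbinom_small ?mulr0. Qed.

Lemma ev_eq0 (phi : nat -> F) p :
  (forall i, (i < size p)%N -> phi i = 0) -> ev phi p = 0.
Proof. by move=> phi0; apply: big1 => i _; rewrite phi0 ?mulr0. Qed.

Lemma ev_top (phi : nat -> F) p N : (size p <= N.+1)%N ->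
  (forall i, (i < N)%N -> phi i = 0) -> ev phi p = p`_N * phi N.
Proof.
move=> sp phi0; rewrite (ev_widen _ sp) big_ord_recr /= big1 ?add0r // => i _.
by rewrite phi0 ?mulr0.
Qed.

(** For n = m + 1 the required total degree 3n equals the sum 3m + 3 of the degrees of the
    arguments, so only the product of the leading coefficients survives. *)
Lemma Lam_staircase_top m : Lam_staircase m m.+1 = q ^+ ('C(m, 2) * 3).
Proof.
have sX c : (size ('X^c * qprod m)%R <= (c + m).+1)%N.
  apply: (leq_trans (size_polyMleq _ _)); rewrite size_polyXn /=.
  by rewrite -addnS leq_add2l size_qprod.
have cX c : ('X^c * qprod m)`_(c + m) = q ^+ 'C(m, 2).
  by rewrite coefXnM ltnNge leq_addr addKn coef_qprod qbinomn mulr1.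
have m0 a b c : a + b + c <> 0 -> macdonald q a b c = 0.
  by rewrite /macdonald; case: eqP.
rewrite /Lam_staircase /Lam (ev_top (sX 2%N)) => [|i lt_i]; last first.
  apply: ev_eq0 => j /leq_trans/(_ (sX _)) lt_j.
  apply: ev_eq0 => k /leq_trans/(_ (sX _)) lt_k; apply: m0; lia.
rewrite (ev_top (sX 1%N)) => [|j lt_j]; last first.
  apply: ev_eq0 => k /leq_trans/(_ (sX _)) lt_k; apply: m0; lia.
rewrite (ev_top (sX 0%N)) => [|k lt_k]; last by apply: m0; lia.
rewrite !cX (_ : macdonald _ _ _ _ = 1) ?mulr1; first by rewrite -!exprD; congr (_ ^+ _); lia.
rewrite /macdonald (_ : (2 + m)%N%:Z - m.+1%:Z = 1); last by lia.
rewrite (_ : (1 + m)%N%:Z - m.+1%:Z = 0); last by lia.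
rewrite (_ : (0 + m)%N%:Z - m.+1%:Z = -1); last by lia.
rewrite (_ : 1 + 0 + -1 = 0 :> int) // eqxx.
by rewrite (_ : chi3 (1 - 0) = 1) // (_ : wt 1 0 = 0) // mul1r.
Qed.

(** Induction on m from the diagonal m = j. At n = j + 1 the recurrence is that of q-binomial
    coefficients in their upper index, and 1 - q^(m+1-j) cancels because q is not a root of
    unity. *)
Lemma Lam_staircaseE m j : (j <= m)%N -> (forall k, (0 < k)%N -> q ^+ k != 1) ->
  Lam_staircase m j.+1 = q ^+ ('C(j, 2) * 3) * qbinom q m j.
Proof.
move=> le_jm qk; elim: m le_jm => [|m IHm].
  by rewrite leqn0 => /eqP ->; rewrite Lam_staircase_top qbinom0 mulr1.
rewrite leq_eqVlt ltnS => /predU1P[-> | le_jm].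
  by rewrite Lam_staircase_top qbinomn mulr1.
have := Lam_staircase_rec m j.+1; rewrite IHm //.
rewrite (_ : 2 - j.+1%:Z + m%:Z = (m.+1 - j)%N%:Z); last by lia.
rewrite -exprnP => E.
apply: (@mulfI _ (1 - q ^+ (m.+1 - j))); first by rewrite subr_eq0 eq_sym qk // subn_gt0.
rewrite E mulrCA [RHS]mulrCA; congr (_ * _).
have nz k : qfact q k != 0.
  by apply/prodf_neq0 => i _; rewrite subr_eq0 eq_sym qk.
apply: (mulfI (mulf_neq0 (nz j) (nz (m - j)%N))).
have := qbinom_qfactD q (m - j)%N j; have := qbinom_qfactD q (m.+1 - j)%N j.
rewrite !subnKC // ?(leqW le_jm) // (subSn le_jm) !qfactS => E1 E2.
rewrite mulrCA (_ : qfact q j * _ * _ = qfact q m); last by rewrite -E2; ring.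
by rewrite mulrC -E1; ring.
Qed.
End AlternantProduct.

Section AlternantSeed.
Variables (F : fieldType) (q : F).
Hypotheses (q_neq0 : q != 0) (two_neq0 : 2%:R != 0 :> F).
Hypothesis qX_neq1 : forall k, (0 < k)%N -> q ^+ k != 1.
Local Notation Lam := (Lam q).
Local Notation qprod := (qprod q).

Lemma Lam_det n (A B C : {poly F}) u2 u1 u0 v2 v1 v0 w2 w1 w0 :
  Lam n (u2 *: A + u1 *: B + u0 *: C) (v2 *: A + v1 *: B + v0 *: C)
    (w2 *: A + w1 *: B + w0 *: C)
  = (u2 * (v1 * w0 - v0 * w1) - u1 * (v2 * w0 - v0 * w2)
     + u0 * (v2 * w1 - v1 * w2)) * Lam n A B C.
Proof.
rewrite !(LamD, LamZ, LamD2, LamZ2, LamD3, LamZ3).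
rewrite !(Lam_alt12 q two_neq0, Lam_alt23 q two_neq0, Lam_alt13 q two_neq0).
rewrite (Lam_swap12 q n B C A) -(Lam_cyc q n B C A) (Lam_cyc q n A B C).
rewrite (Lam_swap12 q n A B C) (Lam_swap23 q n A B C); ring.
Qed.

(* Up to their common part, the three dilated products are quadratic polynomials,
   so that antisymmetry reduces the left-hand side to a 3 x 3 determinant. *)
Lemma qprod_seed a b :
  Lam a.+1 (qprod (a + b).+2) (dil q (qprod (a + b).+2))
    (dil q (dil q (qprod (a + b).+2)))
  = q ^+ (2 + a * 6 + 'C(a, 2) * 3) * qbinom q (a + b) a
    * (1 - q ^+ (a + b).+1) * (1 - q ^+ (a + b).+2) ^+ 2.
Proof.
set m := (a + b)%N; pose Q := dil q (dil q (qprod m)).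
have dilM (p r : {poly F}) : dil q (p * r) = dil q p * dil q r.
  by rewrite /dil rmorphM.
have dil1 (c : F) : dil q (1 + c *: 'X) = 1 + (c * q) *: 'X :> {poly F}.
  apply/polyP => -[|[|i]]; rewrite coef_dil !coefD !coefZ !coef1 !coefX /=; ring.
have dilZ c (p : {poly F}) : dil q (c *: p) = c *: dil q p.
  by rewrite /dil comp_polyZ.
have dilX1 : dil q (1 + 'X) = 1 + q *: 'X by have := dil1 1; rewrite scale1r mul1r.
pose qd (c d : F) := (c * d) *: ('X^2 * Q) + (c + d) *: ('X^1 * Q) + 1 *: ('X^0 * Q).
have qdE c d : (1 + c *: 'X) * (1 + d *: 'X) * Q = qd c d.
  by rewrite /qd -!mul_polyC polyCM polyCD polyC1; ring.
(* The factors 1 + q^k X run over k in 0..m+1, 1..m+2 and 2..m+3 respectively; the common part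
   2..m+1 is [Q]. *)
have e0 : qprod m.+2 = qd 1 q.
  by rewrite -qdE scale1r qprodSl qprodSl dilM dilX1 mulrA.
have e1 : dil q (qprod m.+2) = qd q (q ^+ m.+2).
  rewrite -qdE qprodSl dilM dilX1 qprodS !dilM !dil1 -/Q !exprSr; ring.
have e2 : dil q (dil q (qprod m.+2)) = qd (q ^+ m.+2) (q ^+ m.+3).
  rewrite -qdE !qprodS !dilM !dil1 -/Q !exprSr; ring.
rewrite e2 e1 e0 Lam_det.
(* Dilating twice multiplies X^c by q^(2c), in total q^6 for c = 2, 1, 0; two uses of [Lam_dil]
   supply q^(6(a+1)). *)
have E : q ^+ 6 * Lam a.+1 ('X^2 * Q) ('X^1 * Q) ('X^0 * Q)
    = q ^+ (a.+1 * 6) * Lam_staircase q m a.+1.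
  have dX c : q ^+ (c + c) *: ('X^c * Q) = dil q (dil q ('X^c * qprod m)).
    rewrite dil_mulXn // dilZ dil_mulXn //.
    by rewrite scalerA -exprD.
  have -> : q ^+ 6 = q ^+ (2 + 2) * q ^+ (1 + 1) * q ^+ (0 + 0) by rewrite -!exprD.
  rewrite -mulrA -mulrA -LamZ3 -LamZ2 -LamZ !dX !Lam_dil // mulrA -expfzDr //.
  rewrite -/(Lam_staircase q m a.+1) (exprnP q (a.+1 * 6)); congr (q ^ _ * _); lia.
have E' : Lam a.+1 ('X^2 * Q) ('X^1 * Q) ('X^0 * Q)
    = q ^+ (a * 6) * Lam_staircase q m a.+1.
  apply: (mulfI (expf_neq0 6 q_neq0)); rewrite E mulrA -exprD.
  by congr (q ^+ _ * _); lia.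
rewrite E' (Lam_staircaseE q_neq0) // ?leq_addr //.
rewrite !exprD !exprS expr0; ring.
Qed.
End AlternantSeed.

(** * Exponents attached to the root lattice *)

Definition expo (N x y : int) : int := N * wt x y + 2 - 2 * x - y.

(** When 3 does not divide x - y, it divides (x - y)^2 - 1, and the quotient in [wt] is exact. *)
Lemma wtE (x y : int) : chi3 (x - y) != 0 -> 3 * wt x y + 1 = x ^+ 2 + x * y + y ^+ 2.
Proof.
rewrite /chi3 /wt => chi_neq0; set d := x - y.
have [c [Ed|Ed]] : exists c, d = c * 3 + 1 \/ d = c * 3 + 2.
  exists (d %/ 3)%Z; move: chi_neq0 (divz_eq d 3); rewrite -/d.
  case: ((d %% 3)%Z =P 1) => [-> |_]; first by left.
  by case: ((d %% 3)%Z =P 2) => [-> |_]; first by right.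
- rewrite (@divz_shift (d ^+ 2 - 1) 0 (3 * c ^+ 2 + 2 * c)) ?div0z; last by rewrite Ed; ring.
  have -> : x = c * 3 + 1 + y by rewrite -Ed /d subrK.
  ring.
- rewrite (@divz_shift (d ^+ 2 - 1) 0 (3 * c ^+ 2 + 4 * c + 1)) ?div0z; last by rewrite Ed; ring.
  have -> : x = c * 3 + 2 + y by rewrite -Ed /d subrK.
  ring.
Qed.

(** Completing squares bounds six times this integer below by -1. Taking absolute values of such
    exponents is therefore harmless. *)
Lemma expo2_ge0 (x y : int) : chi3 (x - y) != 0 -> 0 <= expo 2 x y.
Proof.
have H (A B C : int) : 6 * C = A + 3 * B - 1 -> 0 <= A -> 0 <= B -> 0 <= C by lia.
move=> /wtE w.
have E : 6 * expo 2 x y = (2 * x + y - 3) ^+ 2 + 3 * y ^+ 2 - 1.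
  rewrite /expo (_ : 6 * _ = 4 * (3 * wt x y + 1) + 8 - 12 * x - 6 * y); last by ring.
  by rewrite w; ring.
by apply: H E _ _; exact: sqr_ge0.
Qed.

Lemma wtN (x y : int) : wt (- x) (- y) = wt x y.
Proof. by rewrite /wt -opprD sqrrN mulrNN. Qed.

(** Comparison of the powers of t in [seed_field]: i, j, k are the three summation indices, and
    [Ca], [Ci], [Cj], [Ck] stand for binomial coefficients over 2. *)
Lemma expo_balance (a b i j Ca Ci Cj Ck w : int)
  (k := 3 * (a + 1) - i - j) (x := a + 1 - i) (y := a + 1 - j) (M := a + b + 2) :
  2 * Ca = a ^+ 2 - a -> 2 * Ci = i ^+ 2 - i -> 2 * Cj = j ^+ 2 - j ->
  2 * Ck = k ^+ 2 - k -> 3 * w + 1 = x ^+ 2 + x * y + y ^+ 2 ->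
  - Ci - (j + Cj) - (2 * k + Ck) - w - i * (M - i) - j * (M - j) - k * (M - k)
  = - (7 + 9 * a + 3 * (a * b) + 3 * b + 3 * Ca) + (2 * w + 2 - 2 * x - y).
Proof. rewrite /k /x /y /M !expr2; nia. Qed.

Lemma bin2D_succ m n :
  'C((m + n).+1, 2) = ('C(m.+1, 2) + 'C(n.+1, 2) + m * n)%N.
Proof.
elim: n => [|n IHn]; first by rewrite muln0 !addn0.
by rewrite addnS [LHS]binS IHn (binS n.+1 1) !bin1; lia.
Qed.

Lemma bin2_int n : 2 * ('C(n, 2))%:Z = n%:Z ^+ 2 - n%:Z.
Proof.
elim: n => [|n IHn]; first by rewrite bin0n.
by rewrite binS bin1 PoszD mulrDr IHn -(addn1 n) PoszD; ring.
Qed.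

(** * The initial identity, by inversion of q *)

Section Seed.
Variables (F : fieldType) (t : F).
Hypotheses (t_neq0 : t != 0) (two_neq0 : 2%:R != 0 :> F).
Hypothesis tX_neq1 : forall k, (0 < k)%N -> t ^+ k != 1.

Lemma qfact_neq0 n : qfact t n != 0.
Proof. by apply/prodf_neq0 => i _; rewrite subr_eq0 eq_sym tX_neq1. Qed.

Lemma qfactV n : qfact t^-1 n * t ^+ 'C(n.+1, 2) = (-1) ^+ n * qfact t n.
Proof.
elim: n => [|n IHn]; first by rewrite !qfact0 mul1r.
rewrite !qfactS binS bin1 exprD mulrACA IHn exprVn mulrBl mul1r.
rewrite mulVf ?expf_neq0 // (exprS (-1)); ring.
Qed.

Lemma qbinomV m n k : n = (k + m)%N ->
  qbinom t^-1 n k = t ^- (k * m) * qbinom t n k.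
Proof.
move=> ->; have nz i : t ^+ i != 0 by rewrite expf_neq0.
apply: (mulfI (nz (k * m)%N)); rewrite mulrA divff // mul1r.
apply: (mulIf (qfact_neq0 k)); apply: (mulIf (qfact_neq0 m)).
rewrite qbinom_qfactD.
have := qfactV (k + m); rewrite -qbinom_qfactD bin2D_succ (exprD (-1) k m)
  (exprD t ('C(k.+1, 2) + 'C(m.+1, 2)) (k * m)) (exprD t 'C(k.+1, 2)) => E.
apply: (@mulfI _ ((-1) ^+ k * (-1) ^+ m)); first by rewrite mulf_neq0 // signr_eq0.
rewrite -E.
have := qfactV k; have := qfactV m => Em Ek.
transitivity (t ^+ (k * m) * qbinom t^-1 (k + m) k
  * ((-1) ^+ k * qfact t k) * ((-1) ^+ m * qfact t m)); first by ring.
rewrite -Em -Ek; ring.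
Qed.

(** This is [qprod_seed] at q = 1/t, with [Lam] expanded into coefficients and the q-binomials
    inverted back to t. *)
Lemma seed_field a b (M := (a + b).+2) :
  \sum_(i < M.+1) \sum_(j < M.+1) \sum_(k < M.+1)
    (if (i + j + k == 3 * a.+1)%N then
       (chi3 (j%:Z - i%:Z))%:~R * t ^+ `|expo 2 (a.+1%:Z - i%:Z) (a.+1%:Z - j%:Z)|
       * qbinom t M i * qbinom t M j * qbinom t M k else 0)
  = t ^+ (2 * (a * b)) * qbinom t (a + b) a
    * (1 - t ^+ (a + b).+1) * (1 - t ^+ (a + b).+2) ^+ 2.
Proof.
pose q := t^-1; have q0 : q != 0 by rewrite invr_eq0.
have qX k : (0 < k)%N -> q ^+ k != 1 by move=> k0; rewrite exprVn invr_eq1 tX_neq1.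
(* The power of 1/t common to both sides: the prefactor of [qprod_seed], a b from the inverted
   q-binomial, a + b + 1 and twice a + b + 2 from the inverted linear factors, and 2ab to restore
   the target. The three inverted factors also produce a minus sign. *)
pose K := (7 + 9 * a + 3 * (a * b) + 3 * b + 3 * 'C(a, 2))%N.
have tX_neq0 n : t ^+ n != 0 by rewrite expf_neq0.
have := qprod_seed q0 two_neq0 qX a b; rewrite -/M => E.
have RE : q ^+ (2 + a * 6 + 'C(a, 2) * 3) * qbinom q (a + b) a
    * (1 - q ^+ (a + b).+1) * (1 - q ^+ (a + b).+2) ^+ 2
  = - (t ^- K * (t ^+ (2 * (a * b)) * qbinom t (a + b) a
    * (1 - t ^+ (a + b).+1) * (1 - t ^+ (a + b).+2) ^+ 2)).
  rewrite (@qbinomV b) // /q !exprVn.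
  have -> : K = (2 + a * 6 + 'C(a, 2) * 3 + a * b + (a + b).+1 + (a + b).+2 * 2
      + 2 * (a * b))%N by rewrite /K; lia.
  do 5 rewrite (exprD t (_ + _)%N); rewrite (exprM t _.+2 2).
  move: (tX_neq0 (2 + a * 6 + 'C(a, 2) * 3)%N) (tX_neq0 (a * b)%N).
  move: (tX_neq0 (a + b).+1) (tX_neq0 (a + b).+2) (tX_neq0 (2 * (a * b))%N).
  move: (t ^+ (_ + _ + _)) (t ^+ (a * b)) (t ^+ _.+1) (t ^+ _.+2) (t ^+ (2 * _)).
  by move=> x y z u v *; field; do !(apply/andP; split).
have sP : (size (qprod q M) <= M.+1)%N by exact: size_qprod.
have sD (p : {poly F}) : (size p <= M.+1)%N -> (size (dil q p) <= M.+1)%N.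
  by move=> sp; apply/leq_sizeP => i lt_i; rewrite coef_dil nth_default ?mulr0 // (leq_trans sp).
apply: (mulfI (_ : - t ^- K != 0)); first by rewrite oppr_eq0 invr_eq0.
rewrite [RHS]mulNr -RE -E (Lam_sum _ _ sP (sD _ sP) (sD _ (sD _ sP))).
have tE n : q ^+ n = t ^ (- n%:Z) by rewrite /q exprVn -exprnN.
rewrite mulr_sumr; apply: eq_bigr => i _.
rewrite mulr_sumr; apply: eq_bigr => j _.
rewrite mulr_sumr; apply: eq_bigr => k _.
rewrite /macdonald; case: eqP => [Es|Es]; last first.
  by rewrite mulr0; case: eqP => Es'; rewrite ?mulr0 //; lia.
have -> : i%:Z - a.+1%:Z + (j%:Z - a.+1%:Z) + (k%:Z - a.+1%:Z) == 0 by lia.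
(* The denominator is evaluated at the negated weight: [chi3] is odd, which absorbs the minus sign,
   and [wt] is even. *)
rewrite (_ : i%:Z - a.+1%:Z - (j%:Z - a.+1%:Z) = - (j%:Z - i%:Z)); last by lia.
rewrite chi3N; have [-> | chi_neq0] := eqVneq (chi3 (j%:Z - i%:Z)) 0.
  by rewrite oppr0 !(mul0r, mulr0).
set x := a.+1%:Z - i%:Z; set y := a.+1%:Z - j%:Z.
have Exy : x - y = j%:Z - i%:Z by rewrite /x /y; lia.
have e0 : 0 <= expo 2 x y by apply: expo2_ge0; rewrite Exy.
have w3 : 3 * wt x y + 1 = x ^+ 2 + x * y + y ^+ 2 by apply: wtE; rewrite Exy.
rewrite -[X in wt X]opprB -[X in wt _ X]opprB wtN -/x -/y.
rewrite !coef_dil !coef_qprod.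
have leM (l : 'I_M.+1) : (l <= M)%N by rewrite -ltnS.
rewrite !(@qbinomV (M - i) M i) ?(@qbinomV (M - j) M j) ?(@qbinomV (M - k) M k) ?subnKC //.
have pM (l : 'I_M.+1) : (l * (M - l))%N%:Z = l%:Z * (a%:Z + b%:Z + 2 - l%:Z).
  by rewrite PoszM -subzn // /M; congr (_ * _); lia.
have tN n : t ^- n = t ^ (- n%:Z) by rewrite exprnN.
have pw : q ^+ 'C(i, 2) * t ^- (i * (M - i)) * (q ^+ j * q ^+ 'C(j, 2) * t ^- (j * (M - j)))
    * (q ^+ k * q ^+ k * q ^+ 'C(k, 2) * t ^- (k * (M - k))) * q ^ wt x y
    = t ^- K * t ^+ `|expo 2 x y|.
  rewrite !tE !tN (exprnP t `|_|) gez0_abs // /q exprz_inv -!expfzDr //; congr (_ ^ _).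
  have := @expo_balance a b i j _ _ _ ('C(k, 2)) (wt x y) (bin2_int a) (bin2_int i) (bin2_int j).
  have -> : 3 * (a%:Z + 1) - i%:Z - j%:Z = k%:Z by lia.
  have -> : a%:Z + 1 - i%:Z = x by rewrite /x; lia.
  have -> : a%:Z + 1 - j%:Z = y by rewrite /y; lia.
  move=> /(_ (bin2_int k) w3); rewrite !pM /expo /K !PoszD !PoszM; lia.
transitivity (- ((chi3 (j%:Z - i%:Z))%:~R * (t ^- K * t ^+ `|expo 2 x y|)
  * qbinom t M i * qbinom t M j * qbinom t M k)); first by ring.
rewrite -pw rmorphN; ring.
Qed.

End Seed.

Definition seed_sum (R : comNzRingType) (t : R) (a M : nat) : R :=
  \sum_(i < M.+1) \sum_(j < M.+1) \sum_(k < M.+1)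
    (if (i + j + k == 3 * a.+1)%N then
       (chi3 (j%:Z - i%:Z))%:~R * t ^+ `|expo 2 (a.+1%:Z - i%:Z) (a.+1%:Z - j%:Z)|
       * qbinom t M i * qbinom t M j * qbinom t M k else 0).

Lemma rmorph_seed_sum (R S : comNzRingType) (h : {rmorphism R -> S}) t a M :
  h (seed_sum t a M) = seed_sum (h t) a M.
Proof.
rewrite /seed_sum rmorph_sum; apply: eq_bigr => i _; rewrite rmorph_sum.
apply: eq_bigr => j _; rewrite rmorph_sum; apply: eq_bigr => k _.
case: ifP => _; last exact: rmorph0.
by rewrite !rmorphM rmorph_int rmorphXn !rmorph_qbinom.
Qed.

(** Both sides evaluate integer polynomials at t. It suffices to treat the indeterminate in the
    fraction field of Z[X], where it is nonzero and no root of unity, and then to specialize. *)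
Lemma seed_sumE (R : comNzRingType) (t : R) a b :
  seed_sum t a (a + b).+2 = t ^+ (2 * (a * b)) * qbinom t (a + b) a
    * (1 - t ^+ (a + b).+1) * (1 - t ^+ (a + b).+2) ^+ 2.
Proof.
pose rhs (S : comNzRingType) (x : S) := x ^+ (2 * (a * b)) * qbinom x (a + b) a
    * (1 - x ^+ (a + b).+1) * (1 - x ^+ (a + b).+2) ^+ 2.
have rmorph_rhs (S S' : comNzRingType) (h : {rmorphism S -> S'}) x :
    h (rhs S x) = rhs S' (h x).
  by rewrite /rhs !(rmorphXn, rmorphB, rmorphM, rmorph1, rmorph_qbinom).
have EX : seed_sum ('X : {poly int}) a (a + b).+2 = rhs _ 'X.
  apply/eqP; rewrite -tofrac_eq; apply/eqP; rewrite rmorph_seed_sum rmorph_rhs.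
  apply: seed_field.
  - by rewrite tofrac_eq0 polyX_eq0.
  - have : FracField.tofrac (2%:R : {poly int}) != 0 by rewrite tofrac_eq0 -polyC_natr polyC_eq0.
    by rewrite rmorph_nat.
  - move=> k k_gt0; rewrite -rmorphXn -(tofrac1 {poly int}) tofrac_eq.
    apply/eqP => /(congr1 (fun p : {poly int} => size p)).
    by rewrite size_polyXn size_poly1 => -[/eqP]; rewrite -leqn0 leqNgt k_gt0.
pose h : {rmorphism {poly int} -> R} := horner_eval t \o map_poly intr.
have hX : h 'X = t by rewrite /h /= map_polyX /horner_eval hornerX.
by have := congr1 h EX; rewrite rmorph_seed_sum rmorph_rhs hX.
Qed.

(** * The A2 Bailey lemma *)

Lemma qbinomS_alt (R : comNzRingType) (q : R) n k : (k <= n)%N ->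
  qbinom q n.+1 k.+1 = qbinom q n k.+1 + q ^+ (n - k) * qbinom q n k.
Proof.
elim: n k => [|n IHn] k.
  by rewrite leqn0 => /eqP -> /=; rewrite mulr0 add0r addr0 mulr1.
case: k => [_|k le_kn].
  rewrite [LHS]qbinomS [in LHS]IHn // [in RHS]qbinomS !qbinom0 !subn0 !exprS; ring.
rewrite [LHS]qbinomS subSS [in LHS](IHn k) //.
have [lt_kn | ge_kn] := ltnP k n; last first.
  have -> : k = n by lia.
  by rewrite subnn (qbinom_small q (ltnSn n)) (qbinom_small q (ltnSn n.+1)) !qbinomn; ring.
rewrite [in LHS]IHn // [in RHS](qbinomS q n k) [in RHS](qbinomS q n k.+1).
have -> : (n - k = (n - k.+1).+1)%N by lia.
by rewrite (exprS q k.+1) !exprS; ring.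
Qed.

(** The offset d carries the induction on A: Pascal's rule reduces d to d and d + 1. *)
Lemma qVandermonde1 (R : comNzRingType) (q : R) A N d :
  \sum_(p < A.+1) qbinom q A p * q ^+ (p * (p + d)) * qbinom q N (p + d)
  = qbinom q (A + N) (A + d).
Proof.
elim: A d => [|A IHA] d; first by rewrite big_ord1 mulr1 mul1r.
have E1 := IHA d; have E2 := IHA d.+1.
rewrite addSn [in RHS]addSn qbinomS -E1 -(addnS A d) -E2 mulr_sumr.
have -> : \sum_(p < A.+1) qbinom q A p * q ^+ (p * (p + d)) * qbinom q N (p + d)
  = \sum_(p < A.+2) qbinom q A p * q ^+ (p * (p + d)) * qbinom q N (p + d).
  by rewrite [RHS]big_ord_recr /= (qbinom_small q (ltnSn A)) !mul0r addr0.
rewrite big_ord_recl [in RHS]big_ord_recl !qbinom0 -addrA -big_split; congr (_ + _).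
apply: eq_bigr => p _; rewrite qbinomS_alt ?leq_ord // -[lift ord0 p : nat]/(p.+1) addSnnS.
have E : q ^+ (A - p) * q ^+ (p.+1 * (p + d.+1)) = q ^+ (A + d.+1) * q ^+ (p * (p + d.+1)).
  by rewrite -!exprD; congr (_ ^+ _); have := leq_ord p; nia.
transitivity (qbinom q A p.+1 * q ^+ (p.+1 * (p + d.+1)) * qbinom q N (p + d.+1)
  + q ^+ (A - p) * q ^+ (p.+1 * (p + d.+1)) * qbinom q A p * qbinom q N (p + d.+1)).
  by ring.
rewrite E /=; ring.
Qed.

(** The companion summation; here the induction on A reduces (B, d) to (B, d) and (B - 1, d + 1). *)
Lemma qVandermonde2 (R : comNzRingType) (q : R) A B d :
  \sum_(p < A.+1) qbinom q A p * q ^+ ((A - p) * (B - p)) * qbinom q (B + d) (p + d)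
  = qbinom q (A + B + d) (A + d).
Proof.
elim: A B d => [|A IHA] B d; first by rewrite big_ord1 sub0n mul0n mulr1 mul1r.
have E1 := IHA B d; case: B => [|B] in E1 *.
  rewrite big_ord_recl big1 => [|p _]; last first.
    by rewrite (qbinom_small q (_ : 0 + d < lift ord0 p + d)%N) ?mulr0 // lift0; lia.
  by rewrite subnn muln0 qbinom0 !add0n addn0 addr0 !qbinomn !mulr1.
have E2 := IHA B d.+1.
rewrite (_ : (A.+1 + B.+1 + d)%N = (A + B.+1 + d).+1) // (addSn A d).
rewrite (@qbinomS_alt _ q (A + B.+1 + d) (A + d)); last by lia.
rewrite (_ : A + B.+1 + d - (A + d) = B.+1)%N; last by lia.
rewrite (_ : A + B.+1 + d = A + B + d.+1)%N in E1 *; last by lia.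
rewrite -E1 -(addnS A d) -E2 mulr_sumr.
have -> : \sum_(p < A.+1) q ^+ B.+1 * (qbinom q A p * q ^+ ((A - p) * (B.+1 - p))
     * qbinom q (B.+1 + d) (p + d))
  = \sum_(p < A.+2) q ^+ B.+1 * (qbinom q A p * q ^+ ((A - p) * (B.+1 - p))
     * qbinom q (B.+1 + d) (p + d)).
  by rewrite [RHS]big_ord_recr /= (qbinom_small q (ltnSn A)) !mul0r mulr0 addr0.
rewrite [RHS]addrC big_ord_recl [in RHS]big_ord_recl !qbinom0 -addrA -big_split.
congr (_ + _); first by rewrite !subn0 mul1r mul1r mulrA -exprD mulSn.
apply: eq_bigr => p _; rewrite -[lift ord0 p : nat]/(p.+1) (addSnnS p d) (addSnnS B d) qbinomS /=.
(* Beyond B the truncated subtraction falsifies the exponents, but the q-binomial coefficient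
   vanishes. *)
have [lt_Bp | le_pB] := ltnP B p.
  by rewrite (qbinom_small q (_ : B + d.+1 < p + d.+1)%N) ?ltn_add2r // !mulr0 addr0.
have [le_Ap | lt_pA] := leqP A p.
  have -> : p = A :> nat by have := leq_ord p; lia.
  rewrite (qbinom_small q (ltnSn A)) !subSS; ring.
have E : q ^+ p.+1 * q ^+ ((A.+1 - p.+1) * (B.+1 - p.+1))
    = q ^+ B.+1 * q ^+ ((A - p.+1) * (B.+1 - p.+1)).
  by rewrite -!exprD; congr (_ ^+ _); nia.
transitivity (qbinom q A p * q ^+ ((A.+1 - p.+1) * (B.+1 - p.+1)) * qbinom q (B + d.+1) (p + d.+1)
  + q ^+ p.+1 * q ^+ ((A.+1 - p.+1) * (B.+1 - p.+1)) * qbinom q A p.+1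
    * qbinom q (B + d.+1) (p + d.+1)); first by ring.
rewrite E !subSS; ring.
Qed.

Section Bailey.
Variables (R : comUnitRingType) (q : R).
Hypothesis qfact_unit : forall n, qfact q n \is a GRing.unit.

Local Notation Q n := (qfact q n)^-1.

(* 1 / (q)_{m - n}, which vanishes when m < n. *)
Definition qfactV_sub m n : R := if (n <= m)%N then Q (m - n) else 0.
Local Notation iq := qfactV_sub.

Lemma qfactVS n : Q n = (1 - q ^+ n.+1) * Q n.+1.
Proof.
have := qfact_unit n.+1; rewrite qfactS => U.
move: (U); rewrite unitrM => /andP[Un U1].
by rewrite invrM // mulrA divrr // mul1r.
Qed.

Lemma qbinomE k n : qbinom q (k + n) k = qfact q (k + n) * Q k * Q n.
Proof. by rewrite -qbinom_qfactD mulrAC !mulrK. Qed.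

Lemma qbinom_qfactV n k : qbinom q n k * Q n = Q k * iq n k.
Proof.
rewrite /iq; case: leqP => [le_kn | lt_nk]; last by rewrite qbinom_small // mul0r mulr0.
rewrite -{1 2}(subnKC le_kn) qbinomE (mulrC (qfact q _)) mulrAC mulrK //.
Qed.

Lemma iq_addr m n d : iq (m + d) (n + d) = iq m n.
Proof. by rewrite /iq leq_add2r subnDr. Qed.

Lemma sum_iq_widen X N (f : nat -> R) : (X < N)%N ->
  \sum_(i < N) iq X i * f i = \sum_(i < X.+1) iq X i * f i.
Proof.
move=> lt_XN; rewrite (big_ord_widen N (fun i => iq X i * f i) lt_XN) [RHS]big_mkcond.
by apply: eq_bigr => i _; rewrite ltnS /iq; case: leqP => // _; rewrite mul0r.
Qed.

(** A limiting case of q-Chu-Vandermonde. With 1/(q)_X factored out it follows by induction on X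
    from 1/(q)_(Y+1) = 1/(q)_Y + q^(Y+1)/(q)_(Y+1). *)
Lemma sum_qfactV X Y N : (X < N)%N ->
  \sum_(i < N) iq X i * (q ^+ ((X - i) * (Y - i)) * Q i * iq Y i) = Q X * Q Y.
Proof.
move=> ltN; rewrite (sum_iq_widen (fun i => q ^+ ((X - i) * (Y - i)) * Q i * iq Y i) ltN) {N ltN}.
have -> : Q X * Q Y = Q X * \sum_(i < X.+1) qbinom q X i * q ^+ ((X - i) * (Y - i)) * iq Y i.
  congr (_ * _); elim: X Y => [|X IHX] Y; first by rewrite big_ord1 /iq !mul1r subn0.
  case: Y => [|Y].
    rewrite big_ord_recl big1 => [|i _]; last by rewrite mulr0.
    by rewrite qbinom0 mul1r subnn muln0 mul1r addr0 /iq subnn.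
  symmetry; have E1 := IHX Y; have E2 := IHX Y.+1.
  transitivity (Q Y + q ^+ Y.+1 * Q Y.+1); last by rewrite (qfactVS Y); ring.
  rewrite E1 E2 mulr_sumr.
  have -> : \sum_(i < X.+1) q ^+ Y.+1 * (qbinom q X i * q ^+ ((X - i) * (Y.+1 - i)) * iq Y.+1 i)
    = \sum_(i < X.+2) q ^+ Y.+1 * (qbinom q X i * q ^+ ((X - i) * (Y.+1 - i)) * iq Y.+1 i).
    by rewrite [RHS]big_ord_recr /= (qbinom_small q (ltnSn X)) !mul0r mulr0 addr0.
  rewrite [RHS]addrC big_ord_recl [in RHS]big_ord_recl !qbinom0 -addrA -big_split.
  congr (_ + _); first by rewrite !subn0 !mul1r mulrA -exprD mulSn.
  apply: eq_bigr => i _; rewrite -[lift ord0 i : nat]/(i.+1) qbinomS /=.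
  have -> : iq Y.+1 i.+1 = iq Y i by rewrite /iq ltnS subSS.
  rewrite !subSS; have [le_iY | lt_Yi] := leqP i Y; last first.
    by rewrite /iq leqNgt lt_Yi /=; ring.
  have [le_Xi | lt_iX] := leqP X i.
    have -> : i = X :> nat by have := leq_ord i; lia.
    rewrite (qbinom_small q (ltnSn X)); ring.
  have E : q ^+ i.+1 * q ^+ ((X - i) * (Y - i)) = q ^+ Y.+1 * q ^+ ((X - i.+1) * (Y - i)).
    by rewrite -!exprD; congr (_ ^+ _); nia.
  transitivity (qbinom q X i * q ^+ ((X - i) * (Y - i)) * iq Y i
    + q ^+ i.+1 * q ^+ ((X - i) * (Y - i)) * qbinom q X i.+1 * iq Y i); first by ring.
  rewrite E; ring.
rewrite mulr_sumr; apply: eq_bigr => i _.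
transitivity (qbinom q X i * Q X * q ^+ ((X - i) * (Y - i)) * iq Y i); last by ring.
rewrite qbinom_qfactV; ring.
Qed.

(* The value of f_{A+k1,B-k3} at a dominant weight (k1, k2, k3), in terms of
   d = k1 - k2 and e = k2 - k3. *)
Definition bailey_dom A B d e :=
  qfact q (A + B + d + e) * (Q A * Q (A + d) * Q (A + d + e))
  * (Q B * Q (B + e) * Q (B + d + e)).

Lemma sum_qVandermonde1 A B d N : (A < N)%N ->
  \sum_(p < N) iq A p * (q ^+ (p * (p + d)) * iq B p * Q p * Q (p + d))
  = qfact q (A + B + d) * Q A * Q (A + d) * Q B * Q (B + d).
Proof.
move=> ltN; rewrite (sum_iq_widen (fun i => q ^+ (i * (i + d)) * iq B i * Q i * Q (i + d)) ltN) {N ltN}.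
transitivity (qbinom q (A + (B + d)) (A + d) * Q A * Q (B + d)).
  rewrite -qVandermonde1 !mulr_suml; apply: eq_bigr => p _.
  transitivity (q ^+ (p * (p + d)) * (qbinom q A p * Q A)
    * (qbinom q (B + d) (p + d) * Q (B + d))); last by ring.
  by rewrite !qbinom_qfactV iq_addr; ring.
by rewrite (_ : A + (B + d) = A + d + B)%N ?qbinomE 1?addnAC 1?[(B + A)%N]addnC; [ring | lia].
Qed.

Lemma sum_qVandermonde2 A B d N : (A < N)%N ->
  \sum_(p < N) iq A p * (q ^+ ((A - p) * (B - p)) * iq B p * Q p * Q (p + d))
  = qfact q (A + B + d) * Q A * Q (A + d) * Q B * Q (B + d).
Proof.
move=> ltN; rewrite (sum_iq_widen (fun i => q ^+ ((A - i) * (B - i)) * iq B i * Q i * Q (i + d)) ltN) {N ltN}.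
transitivity (qbinom q (A + B + d) (A + d) * Q A * Q (B + d)).
  rewrite -qVandermonde2 !mulr_suml; apply: eq_bigr => p _.
  transitivity (q ^+ ((A - p) * (B - p)) * (qbinom q A p * Q A)
    * (qbinom q (B + d) (p + d) * Q (B + d))); last by ring.
  by rewrite !qbinom_qfactV iq_addr; ring.
by rewrite addnAC qbinomE; ring.
Qed.

(* Expanding [bailey_dom] by [sum_qVandermonde2] decouples the sums over r and s. *)
Lemma bailey_lemma_dom A B d e :
  \sum_(r < A.+1) \sum_(s < B.+1) q ^+ (r ^ 2 + s ^ 2 - r * s + r * d + s * e)
    * Q (A - r) * Q (B - s) * bailey_dom r s d e = bailey_dom A B d e.
Proof.
have bfE (r : 'I_A.+1) s : bailey_dom r s d e = Q (r + d + e) * Q s *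
   \sum_(p < A.+1) iq r p * (q ^+ ((r - p) * (s + e - p)) * iq (s + e) p * Q p * Q (p + d)).
  rewrite sum_qVandermonde2 // /bailey_dom addnA !(addnAC _ e d); ring.
transitivity (\sum_(p < A.+1) q ^+ (p * (p + d)) * Q p * Q (p + d)
  * (\sum_(r < A.+1) q ^+ ((r - p) * (r + d + e)) * Q (A - r) * iq r p * Q (r + d + e))
  * (\sum_(s < B.+1) q ^+ (s * (s + e - p)) * Q (B - s) * Q s * iq (s + e) p)).
  transitivity (\sum_(r < A.+1) \sum_(s < B.+1) \sum_(p < A.+1)
      q ^+ (p * (p + d)) * Q p * Q (p + d)
      * (q ^+ ((r - p) * (r + d + e)) * Q (A - r) * iq r p * Q (r + d + e))
      * (q ^+ (s * (s + e - p)) * Q (B - s) * Q s * iq (s + e) p)).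
    apply: eq_bigr => r _; apply: eq_bigr => s _; rewrite bfE !mulr_sumr.
    apply: eq_bigr => p _.
    have [le_pr | lt_rp] := leqP p r; last first.
      by rewrite /iq [(p <= r)%N]leqNgt lt_rp /=; ring.
    have [le_ps | lt_sp] := leqP p (s + e); last first.
      by rewrite /iq [(p <= s + e)%N]leqNgt lt_sp /=; ring.
    (* The mixed term - r s cancels, so for fixed p the exponent separates into a part in r and a
       part in s. *)
    have E : q ^+ (r ^ 2 + s ^ 2 - r * s + r * d + s * e) * q ^+ ((r - p) * (s + e - p))
        = q ^+ (p * (p + d)) * q ^+ ((r - p) * (r + d + e)) * q ^+ (s * (s + e - p)).
      rewrite -!exprD; congr (_ ^+ _).
      have le_rs : (r * s <= r ^ 2 + s ^ 2)%N by rewrite -!mulnn; nia.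
      move: le_pr le_ps le_rs; rewrite -!mulnn.
      move: (nat_of_ord p) (nat_of_ord r) (nat_of_ord s) => p' r' s' *.
      nia.
    transitivity (q ^+ (r ^ 2 + s ^ 2 - r * s + r * d + s * e) * q ^+ ((r - p) * (s + e - p))
      * Q (A - r) * Q (B - s) * (Q (r + d + e) * Q s * iq r p * iq (s + e) p * Q p * Q (p + d))).
      by ring.
    rewrite E; ring.
  under eq_bigr => r _ do rewrite exchange_big /=.
  rewrite exchange_big /=; apply: eq_bigr => p _.
  under eq_bigr => r _ do rewrite -mulr_sumr.
  by rewrite -mulr_suml -mulr_sumr.
have sum_r (p : 'I_A.+1) : \sum_(r < A.+1) q ^+ ((r - p) * (r + d + e)) * Q (A - r) * iq r p
    * Q (r + d + e) = iq A p * Q (A + d + e).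
  have le_pA : (p <= A)%N by rewrite -ltnS.
  (* Reversing the order of summation, r -> A - r, gives the shape of [sum_qfactV]. *)
  rewrite (reindex_inj rev_ord_inj) /=.
  transitivity (\sum_(i < A.+1) iq (A - p) i
    * (q ^+ ((A - p - i) * (A + d + e - i)) * Q i * iq (A + d + e) i)).
    apply: eq_bigr => i _; have le_iA : (i <= A)%N by rewrite -ltnS.
    rewrite subSS /iq (subKn le_iA) (_ : (p <= A - i) = (i <= A - p))%N; last by lia.
    have -> : (i <= A + d + e)%N by lia.
    case: leqP => le_ip; last by ring.
    rewrite subnAC (_ : A - i + d + e = A + d + e - i)%N; last by lia.
    ring.
  by rewrite sum_qfactV ?ltnS ?leq_subr // /iq le_pA.
have sum_s p : \sum_(s < B.+1) q ^+ (s * (s + e - p)) * Q (B - s) * Q s * iq (s + e) p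
   = Q B * iq (B + e) p.
  rewrite (reindex_inj rev_ord_inj) /=.
  transitivity (\sum_(i < B.+1) iq B i
    * (q ^+ ((B - i) * (B + e - p - i)) * Q i * (if (p <= B + e)%N then iq (B + e - p) i else 0))).
    apply: eq_bigr => i _; have le_iB : (i <= B)%N by rewrite -ltnS.
    rewrite subSS /iq (subKn le_iB) le_iB (_ : B - i + e = B + e - i)%N; last by lia.
    have [le_pB | lt_Bp] := leqP p (B + e); last first.
      by rewrite leqNgt (leq_ltn_trans _ lt_Bp) ?leq_subr //=; ring.
    rewrite (_ : (p <= B + e - i) = (i <= B + e - p))%N; last by lia.
    case: leqP => le_ip; last by ring.
    rewrite subnAC; ring.
  rewrite [X in _ = _ * X]/iq; case: (leqP p (B + e)) => [le_pB | lt_Bp]; first by rewrite sum_qfactV.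
  by rewrite mulr0 big1 // => i _; rewrite !mulr0.
transitivity (Q (A + d + e) * Q B *
  \sum_(p < A.+1) iq A p * (q ^+ (p * (p + d)) * iq (B + e) p * Q p * Q (p + d))).
  rewrite mulr_sumr; apply: eq_bigr => p _; rewrite sum_r sum_s; ring.
by rewrite sum_qVandermonde1 // /bailey_dom addnA !(addnAC _ e d); ring.
Qed.
End Bailey.

(** * Summation of formal power series *)

Section Congruence.
Variable R : comUnitRingType.
Implicit Types f g h : fps R.

(** Congruence modulo X^K, through which limits and infinite sums are handled. *)
Definition eqm (K : nat) f g := forall n, (n < K)%N -> f n = g n.

Lemma eqm_refl K f : eqm K f f. Proof. by []. Qed.

Lemma eqm_sym K f g : eqm K f g -> eqm K g f.
Proof. by move=> fg n /fg. Qed.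

Lemma eqm_trans K g f h : eqm K f g -> eqm K g h -> eqm K f h.
Proof. by move=> fg gh n lt_nK; rewrite fg ?gh. Qed.

Lemma eqmP f g : (forall K, eqm K f g) -> f = g.
Proof. by move=> fg; apply/fpsP => n; apply: (fg n.+1). Qed.

Lemma eqmD K f f' g g' : eqm K f f' -> eqm K g g' -> eqm K (f + g) (f' + g').
Proof. by move=> ff gg n lt_n; rewrite !fpsDE ff ?gg. Qed.

Lemma eqmM K f f' g g' : eqm K f f' -> eqm K g g' -> eqm K (f * g) (f' * g').
Proof.
move=> ff gg n lt_n; rewrite !fpsME; apply: eq_bigr => i _.
by rewrite ff ?gg // (leq_ltn_trans _ lt_n) ?leq_subr // -ltnS.
Qed.

Lemma eqm_sum K (I : Type) (r : seq I) (P : pred I) (F G : I -> fps R) :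
  (forall i, P i -> eqm K (F i) (G i)) ->
  eqm K (\sum_(i <- r | P i) F i) (\sum_(i <- r | P i) G i).
Proof. by move=> FG; apply: big_ind2 => // *; exact: eqmD. Qed.

Lemma eqm_sum0 K (I : Type) (r : seq I) (P : pred I) (F : I -> fps R) :
  (forall i, P i -> eqm K (F i) 0) -> eqm K (\sum_(i <- r | P i) F i) 0.
Proof.
move=> F0; have := eqm_sum r F0; rewrite [X in eqm _ _ X -> _]big1 //.
Qed.

Lemma eqm_prod K (I : Type) (r : seq I) (P : pred I) (F G : I -> fps R) :
  (forall i, P i -> eqm K (F i) (G i)) ->
  eqm K (\prod_(i <- r | P i) F i) (\prod_(i <- r | P i) G i).
Proof. by move=> FG; apply: big_ind2 => // *; exact: eqmM. Qed.

Lemma eqmV K f g : f \is a GRing.unit -> g \is a GRing.unit ->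
  eqm K f g -> eqm K f^-1 g^-1.
Proof.
move=> fu gu fg; have -> : f^-1 = f^-1 * (g * g^-1) by rewrite divrr ?mulr1.
have {2}-> : g^-1 = f^-1 * (f * g^-1) by rewrite mulrA mulVr ?mul1r.
by apply: eqmM => //; apply: eqmM => //; apply: eqm_sym.
Qed.

Lemma eqm_Xn0 K n f : (K <= n)%N -> eqm K (fpsX R ^+ n * f) 0.
Proof. by move=> le_Kn i lt_i; rewrite fpsMXnE (leq_trans lt_i). Qed.

(** * Unconditional sums of families of power series *)

Section HasSum.
Variable I : choiceType.
Implicit Types (F G : I -> fps R) (S T : fps R).

Definition hassum F S := forall K, exists s : seq I,
  [/\ uniq s, forall i, i \notin s -> eqm K (F i) 0 & eqm K (\sum_(i <- s) F i) S].

(** Two admissible lists are compared through their union, where the additional terms vanish modulo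
    X^K. *)
Lemma hassum_seq F S K s : hassum F S -> uniq s ->
  (forall i, i \notin s -> eqm K (F i) 0) -> eqm K (\sum_(i <- s) F i) S.
Proof.
move=> /(_ K)[s' [us' F0 FS]] us F0'; apply: eqm_trans FS.
pose t := undup (s ++ s').
have widen (r : seq I) : uniq r -> {subset r <= t} -> (forall i, i \notin r -> eqm K (F i) 0) ->
    eqm K (\sum_(i <- r) F i) (\sum_(i <- t) F i).
  move=> ur rt r0; have -> : \sum_(i <- r) F i = \sum_(i <- t | i \in r) F i.
    rewrite -[RHS]big_filter; apply: perm_big; apply: uniq_perm => //.
      by rewrite filter_uniq // undup_uniq.
    by move=> i; rewrite mem_filter; case ir: (i \in r) => //=; rewrite rt.
  rewrite [X in eqm _ _ X](bigID (mem r)) /= -[X in eqm _ X _]addr0.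
  apply: eqmD; first exact: eqm_refl; apply: eqm_sym.
  by apply: eqm_sum0 => i /r0.
apply: (eqm_trans (widen s _ _ _)) => //.
  by move=> i; rewrite mem_undup mem_cat => ->.
apply/eqm_sym/widen => // i; by rewrite mem_undup mem_cat orbC => ->.
Qed.

Lemma eq_hassum F G S : F =1 G -> hassum F S -> hassum G S.
Proof.
move=> FG FS K; have [s [us F0 FsS]] := FS K; exists s; split=> //.
  by move=> i /F0; rewrite FG.
by apply: eqm_trans FsS; rewrite (eq_bigr _ (fun i _ => FG i)); apply: eqm_refl.
Qed.

Lemma hassumM c F S : hassum F S -> hassum (fun i => c * F i) (c * S).
Proof.
move=> FS K; have [s [us F0 FsS]] := FS K; exists s; split=> // [i /F0 Fi0|].
  by rewrite -(mulr0 c); apply: eqmM => //; apply: eqm_refl.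
by rewrite -mulr_sumr; apply: eqmM => //; apply: eqm_refl.
Qed.

(** Once the finite support is closed under [sg], the partial sum equals its own opposite. *)
Lemma hassum_anti F (sg : I -> I) : (forall x : fps R, x = - x -> x = 0) ->
  (forall K, exists s : seq I, forall i, i \notin s -> eqm K (F i) 0) ->
  involutive sg -> (forall i, F (sg i) = - F i) -> hassum F 0.
Proof.
move=> two F0 sgK Fsg K; have [s s0] := F0 K.
pose t := undup (s ++ map sg s); exists t; split.
- exact: undup_uniq.
- by move=> i; rewrite mem_undup mem_cat negb_or => /andP[/s0].
have -> : \sum_(i <- t) F i = 0; last exact: eqm_refl.
apply: two; rewrite -sumrN.
have inj := inv_inj sgK.
have map_sg r i : (i \in map sg r) = (sg i \in r) by rewrite -{1}(sgK i) (mem_map inj).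
have Et : perm_eq (map sg t) t.
  apply: uniq_perm; rewrite ?(map_inj_uniq inj) ?undup_uniq // => i.
  by rewrite map_sg !mem_undup !mem_cat !map_sg sgK orbC.
by rewrite -[LHS](perm_big _ Et) big_map; apply: eq_bigr => i _; rewrite Fsg.
Qed.

End HasSum.

Lemma hassum_reindex (I J : choiceType) (h : J -> I) (h' : I -> J) F S :
  cancel h h' -> cancel h' h -> hassum F S -> hassum (F \o h) S.
Proof.
move=> hK h'K FS K; have [s [us F0 FsS]] := FS K; exists (map h' s); split.
- by rewrite map_inj_uniq //; exact: can_inj h'K.
- by move=> j js; apply: F0; apply: contra js => js; rewrite -(hK j) map_f.
by rewrite big_map; apply: eqm_trans FsS; under eq_bigr do rewrite /= h'K; apply: eqm_refl.
Qed.

Lemma hassum_mul (I J : choiceType) (F : I -> fps R) (G : J -> fps R) S T :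
  hassum F S -> hassum G T -> hassum (fun x : I * J => F x.1 * G x.2) (S * T).
Proof.
move=> FS GT K; have [s [us F0 FsS]] := FS K; have [t [ut G0 GtT]] := GT K.
exists [seq (i, j) | i <- s, j <- t]; split.
- by apply: allpairs_uniq => // -[i j] [i' j'].
- move=> [i j] /=; have [is_ | iNs] := boolP (i \in s).
    move=> ijN; have /G0 Gj0 : j \notin t.
      by apply: contra ijN => jexp; apply/allpairsP; exists (i, j).
    by rewrite -(mulr0 (F i)); apply: eqmM => //; apply: eqm_refl.
  by move=> _; rewrite -(mul0r (G j)); apply: eqmM; [exact: F0 | exact: eqm_refl].
rewrite big_allpairs /=; under eq_bigr do rewrite -mulr_sumr.
by rewrite -mulr_suml; apply: eqmM.
Qed.

(** Modulo X^K the support is enclosed in a finite rectangle, where the double sum is iterated. *)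
Lemma hassum_fubini (I J : choiceType) (F : I * J -> fps R) G S :
  hassum F S -> (forall i, hassum (fun j => F (i, j)) (G i)) -> hassum G S.
Proof.
move=> FS FG K; have [s [us F0 FsS]] := FS K.
pose a := undup (map fst s); pose b := undup (map snd s).
have ab0 ij : ij \notin [seq (i, j) | i <- a, j <- b] -> eqm K (F ij) 0.
  move=> ijN; apply: F0; apply: contra ijN => ijs; apply/allpairsP; exists ij.
  by rewrite !mem_undup !map_f //; case: ij ijs.
exists a; split; first exact: undup_uniq.
  move=> i iN; have [t [_ _ /eqm_sym GiK]] := FG i K; apply: eqm_trans GiK _.
  apply: eqm_sum0 => j _; apply: F0; apply: contra iN => ijs.
  by rewrite mem_undup; apply/mapP; exists (i, j).
have := hassum_seq FS (_ : uniq [seq (i, j) | i <- a, j <- b]) ab0.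
rewrite big_allpairs => FabS; apply: eqm_trans (FabS _); last first.
  by apply: allpairs_uniq; rewrite ?undup_uniq // => -[? ?] [? ?].
apply: eqm_sum => i _; apply: eqm_sym; apply: hassum_seq (FG i) _ _; first exact: undup_uniq.
move=> j jN; apply: ab0; apply: contra jN => /allpairsP[[i' j'] [_ jb [_ ->]]].
exact: jb.
Qed.

End Congruence.

(** * Jacobi triple product *)

(** The q-binomial theorem, homogeneous so that the finite triple product avoids negative powers. *)
Lemma qbinomial (R : comNzRingType) (q u v : R) m :
  \prod_(k < m) (u + q ^+ k * v)
  = \sum_(j < m.+1) qbinom q m j * q ^+ 'C(j, 2) * u ^+ (m - j) * v ^+ j.
Proof.
elim: m => [|m IHm]; first by rewrite big_ord0 big_ord1 !mulr1.
rewrite big_ord_recr [X in _ * X]/= IHm [LHS]mulrC mulrDl !mulr_sumr.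
have -> : \sum_(j < m.+1) u * (qbinom q m j * q ^+ 'C(j, 2) * u ^+ (m - j) * v ^+ j)
  = \sum_(j < m.+2) qbinom q m j * q ^+ 'C(j, 2) * u ^+ (m.+1 - j) * v ^+ j.
  rewrite [RHS]big_ord_recr /= (qbinom_small q (ltnSn m)) !mul0r addr0.
  by apply: eq_bigr => j _; rewrite subSn ?leq_ord // exprS; ring.
rewrite big_ord_recl [RHS]big_ord_recl !qbinom0 -addrA -big_split; congr (_ + _).
apply: eq_bigr => j _; rewrite -[lift ord0 j : nat]/(j.+1) qbinomS_alt ?leq_ord //=.
have E : q ^+ m * q ^+ 'C(j, 2) = q ^+ (m - j) * q ^+ 'C(j.+1, 2).
  by rewrite -!exprD binS bin1 addnCA subnK ?leq_ord // addnC.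
transitivity (qbinom q m j.+1 * q ^+ 'C(j.+1, 2) * u ^+ (m - j) * v ^+ j.+1
  + q ^+ m * q ^+ 'C(j, 2) * qbinom q m j * u ^+ (m - j) * v ^+ j.+1).
  by rewrite subSS (exprS v); ring.
rewrite E subSS; ring.
Qed.

Section QPochhammerLimit.
Variable R : comUnitRingType.
Implicit Types (a q : fps R).
Local Notation X := (fpsX R).

Lemma qpochE q n : qpoch q q n = qfact q n.
Proof. by apply: eq_bigr => k _; rewrite exprS. Qed.

Lemma qpoch_stable a q n L m : q 0%N = 0 -> (n < L)%N -> (L <= m)%N ->
  qpoch a q m n = qpoch a q L n.
Proof.
move=> q0 lt_nL; elim: m => [|m IHm]; first by rewrite leqn0 => /eqP ->.
rewrite leq_eqVlt => /predU1P[-> // | le_Lm]; rewrite -IHm //.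
rewrite qpochS mulrBr mulr1 mulrA fpsBE fps_coef_mul_exp ?subr0 //.
exact: leq_trans lt_nL _.
Qed.

Lemma qpoch_inf_eqm a q K L : q 0%N = 0 -> (K <= L)%N ->
  eqm K (qpoch_inf a q) (qpoch a q L).
Proof.
move=> q0 le_KL n lt_nK; have [N EN] := qpoch_cvg a q0 n.
rewrite -(EN (maxn N L)) ?leq_maxl // (@qpoch_stable _ _ n L) ?leq_maxr //.
exact: leq_trans lt_nK _.
Qed.

Lemma qfact_eqm q K L : q 0%N = 0 -> (K <= L)%N ->
  eqm K (qpoch_inf q q) (qfact q L).
Proof. by move=> q0 le_KL; rewrite -qpochE; apply: qpoch_inf_eqm. Qed.

Lemma fps_qfact_unit q n : q 0%N = 0 -> qfact q n \is a GRing.unit.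
Proof.
move=> q0; rewrite fps_unitE (_ : qfact q n 0%N = 1) ?unitr1 //.
elim: n => [|n IHn]; first by rewrite qfact0.
by rewrite qfactS fpsM0E IHn fpsBE fps1E exprS fpsM0E q0 mul0r subr0 mulr1.
Qed.

Lemma qpoch_inf_unit a q : a 0%N = 0 -> q 0%N = 0 ->
  qpoch_inf a q \is a GRing.unit.
Proof.
move=> a0 q0; rewrite fps_unitE (qpoch_inf_eqm a q0 (leqnn 1)) //.
by rewrite /qpoch big_ord1 mulr1 fpsBE a0 subr0 unitr1.
Qed.

Lemma fpsXn0 m : (0 < m)%N -> (X ^+ m) 0%N = 0.
Proof. by case: m => // m _; rewrite exprS fpsM0E mul0r. Qed.

(** The multiples of m are sorted into classes modulo m n, first in a product of n L factors. *)
Lemma qpoch_inf_dissect m n : (0 < m)%N -> (0 < n)%N ->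
  qpoch_inf (X ^+ m) (X ^+ m)
  = \prod_(i < n) qpoch_inf (X ^+ (m * i.+1)) (X ^+ (m * n)).
Proof.
move=> m0 n0; apply: eqmP => K.
have fin L : qpoch (X ^+ m) (X ^+ m) (n * L)
    = \prod_(i < n) qpoch (X ^+ (m * i.+1)) (X ^+ (m * n)) L.
  elim: L => [|L IHL].
    by rewrite muln0 [LHS]big_ord0 big1 // => i _; exact: big_ord0.
  rewrite mulnS addnC /qpoch big_split_ord /= -/(qpoch _ _ _) IHL.
  under [in RHS]eq_bigr do rewrite big_ord_recr /=.
  rewrite [RHS]big_split /=; congr (_ * _); apply: eq_bigr => i _.
  by rewrite -!exprM -!exprD; congr (1 - _ ^+ _); nia.
apply: eqm_trans (qpoch_inf_eqm _ _ (_ : K <= n * K)%N) _; rewrite ?fpsXn0 ?leq_pmull //.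
rewrite fin; apply: eqm_prod => i _; apply/eqm_sym/qpoch_inf_eqm => //.
by rewrite fpsXn0 // muln_gt0 m0.
Qed.

Definition tri (n : int) : int := ((n * (n - 1)) %/ 2)%Z.

Lemma triE (n : int) : 2 * tri n = n * (n - 1).
Proof.
have [c [->|->]] : exists c, n = c * 2 \/ n = c * 2 + 1 by exists (n %/ 2)%Z; lia.
- by rewrite /tri [X in (X %/ 2)%Z](_ : _ = c * (c * 2 - 1) * 2) ?mulzK //; ring.
- by rewrite /tri [X in (X %/ 2)%Z](_ : _ = c * (c * 2 + 1) * 2) ?mulzK //; ring.
Qed.

(** Exponent of p^(n(n-1)/2) z^n for p = X^N and z = X^i. *)
Definition jexp (N i n : int) : int := N * tri n + i * n.

Definition jterm (N i n : int) : fps R := (-1) ^+ `|n| * X ^+ `|jexp N i n|.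

(** This gives both the nonnegativity of the exponents and the summability of the series. *)
Lemma jexp_ge (N i n : int) : 0 < i -> i < N -> `|n| <= jexp N i n.
Proof.
move=> i0 iN; have := triE n; rewrite /jexp; move: (tri n) => T ET.
have [n_ge0 | n_lt0] := lerP 0 n.
  have T0 : 0 <= T by nia.
  have : 0 <= N * T by apply: mulr_ge0 => //; lia.
  nia.
have Tn : - n <= T by nia.
have : N * (- n) <= N * T by apply: ler_wpM2l => //; lia.
nia.
Qed.

End QPochhammerLimit.

Section JacobiTripleProduct.
Variable R : comUnitRingType.
Local Notation X := (fpsX R).

Lemma eqm_jterm K (N i n : int) : 0 < i -> i < N -> (K <= `|n|)%N ->
  eqm K (jterm R N i n) 0.
Proof.
move=> i0 iN le_Kn; rewrite /jterm mulrC.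
by apply: eqm_Xn0; apply: leq_trans le_Kn _; have := jexp_ge n i0 iN; lia.
Qed.

(** The q-binomial theorem for 2L factors X^(NL) - X^(Nk+i): the first L, with the larger powers
    taken out, form one Pochhammer symbol and the last L the other. *)
Lemma jacobi_triple_fin (N i L : nat) : (0 < i < N)%N ->
  qpoch (X ^+ i) (X ^+ N) L * qpoch (X ^+ (N - i)) (X ^+ N) L
  = \sum_(j < (L + L).+1) jterm R N i (j%:Z - L%:Z) * qbinom (X ^+ N) (L + L) j.
Proof.
move=> /andP[i0 iN]; pose p := X ^+ N.
(* The total power of X taken out of the 2L factors, cancelled at the end. *)
pose c := (\sum_(k < L) (N * k + i) + N * L * L)%N.
have cE : (c%:Z = N%:Z * 'C(L, 2)%:Z + i%:Z * L%:Z + N%:Z * L%:Z * L%:Z)%R.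
  rewrite /c big_split /= -big_distrr /= sum_nat_const card_ord.
  rewrite -(big_mkord xpredT id) -bin2_sum; lia.
have := qbinomial p (X ^+ (N * L)) (- X ^+ i) (L + L).
rewrite big_split_ord /=.
have -> : \prod_(k < L) (X ^+ (N * L) + p ^+ k * - X ^+ i)
    = (-1) ^+ L * X ^+ (\sum_(k < L) (N * k + i)) * qpoch (X ^+ (N - i)) p L.
  have -> : (-1) ^+ L = \prod_(k < L) (-1 : fps R) by rewrite prodr_const card_ord.
  rewrite /qpoch [X in _ * X](reindex_inj rev_ord_inj) /= -prodrXr -!big_split /=.
  apply: eq_bigr => k _.
  have -> : X ^+ (N * L) = X ^+ (N * k + i) * (X ^+ (N - i) * p ^+ (L - k.+1)).
    by rewrite -exprM -!exprD; congr (_ ^+ _); have := ltn_ord k; nia.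
  have E2 : p ^+ k * X ^+ i = X ^+ (N * k + i) by rewrite -exprM -exprD.
  rewrite mulrN E2 /=; ring.
have -> : \prod_(k < L) (X ^+ (N * L) + p ^+ (L + k) * - X ^+ i)
    = X ^+ (N * L * L) * qpoch (X ^+ i) p L.
  have -> : X ^+ (N * L * L) = \prod_(k < L) (X ^+ (N * L)) by rewrite prodr_const card_ord -exprM.
  rewrite /qpoch -big_split /=; apply: eq_bigr => k _.
  by rewrite mulrBr mulr1 mulrN -!exprM -!exprD; congr (_ - _ ^+ _); lia.
move=> E; apply: (@fpsX_lreg _ c); apply: (@mulrI _ ((-1) ^+ L)); first exact: unitrX (unitrN1 _).
transitivity ((-1) ^+ L * X ^+ (\sum_(k < L) (N * k + i)) * qpoch (X ^+ (N - i)) p L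
  * (X ^+ (N * L * L) * qpoch (X ^+ i) p L)); first by rewrite /c exprD; ring.
rewrite E !mulr_sumr; apply: eq_bigr => j _; rewrite -/p /jterm.
have Es : (-1) ^+ j = (-1) ^+ L * (-1) ^+ `|j%:Z - L%:Z| :> fps R.
  by rewrite -exprD -signr_odd -[RHS]signr_odd; congr (_ ^+ nat_of_bool _); lia.
have Ex : p ^+ 'C(j, 2) * X ^+ (N * L) ^+ (L + L - j) * X ^+ i ^+ j
    = X ^+ c * X ^+ `|jexp N i (j%:Z - L%:Z)|.
  rewrite -!exprM -!exprD; congr (_ ^+ _).
  have jL : (j <= L + L)%N by rewrite -ltnS.
  have jt0 : 0 <= jexp N i (j%:Z - L%:Z).
    by apply: le_trans (jexp_ge _ _ _); rewrite ?normr_ge0 // ltz_nat.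
  have : N%:Z * 'C(j, 2)%:Z + N%:Z * L%:Z * (L%:Z + L%:Z - j%:Z) + i%:Z * j%:Z
      = c%:Z + jexp N i (j%:Z - L%:Z).
    apply: (@mulfI _ (2 : int)) => //; rewrite cE /jexp.
    transitivity (N%:Z * (2 * 'C(j, 2)%:Z) + 2 * (N%:Z * L%:Z * (L%:Z + L%:Z - j%:Z) + i%:Z * j%:Z)).
      by ring.
    transitivity (N%:Z * (2 * 'C(L, 2)%:Z) + 2 * (i%:Z * L%:Z + N%:Z * L%:Z * L%:Z)
      + N%:Z * (2 * tri (j%:Z - L%:Z)) + 2 * (i%:Z * (j%:Z - L%:Z))); last by ring.
    rewrite !bin2_int triE; ring.
  move=> E'; apply/eqP; rewrite -eqz_nat; apply/eqP.
  rewrite (PoszD c) gez0_abs // -E' !PoszD !PoszM -subzn // PoszD; ring.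
rewrite (exprNn (X ^+ i) j) Es.
transitivity ((-1) ^+ L * (-1) ^+ `|j%:Z - L%:Z| * qbinom p (L + L) j
  * (p ^+ 'C(j, 2) * X ^+ (N * L) ^+ (L + L - j) * X ^+ i ^+ j)); first by ring.
rewrite Ex; ring.
Qed.
End JacobiTripleProduct.

Section ThetaSums.
Variable R : comUnitRingType.
Local Notation X := (fpsX R).

(** All three factorials in the q-binomial coefficient agree with (q)_oo modulo X^K. *)
Lemma qbinom_central_eqm K m j : (K <= j)%N -> (K <= m - j)%N -> (j <= m)%N ->
  forall q : fps R, q 0%N = 0 -> eqm K (qbinom q m j * qpoch_inf q q) 1.
Proof.
move=> Kj Kmj jm q q0; pose P := qpoch_inf q q.
have qpoch_infX_unit : P \is a GRing.unit by exact: qpoch_inf_unit.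
have H : eqm K (qbinom q m j * P * P) P.
  apply: (@eqm_trans _ _ (qbinom q m j * qfact q j * qfact q (m - j))).
    apply: eqmM; last exact: qfact_eqm.
    by apply: eqmM; [exact: eqm_refl | exact: qfact_eqm].
  have := qbinom_qfactD q (m - j) j; rewrite subnKC // => ->.
  by apply/eqm_sym/qfact_eqm => //; apply: leq_trans jm.
rewrite -(mulrK qpoch_infX_unit (_ * P)) -(divrr qpoch_infX_unit).
by apply: eqmM => //; exact: eqm_refl.
Qed.

Lemma jacobi_triple (N i : nat) : (0 < i < N)%N ->
  hassum (jterm R N i) (qpoch_inf (X ^+ N) (X ^+ N) *
    (qpoch_inf (X ^+ i) (X ^+ N) * qpoch_inf (X ^+ (N - i)) (X ^+ N))).
Proof.
move=> /[dup] iN /andP[i_gt0 i_ltN] K; pose L := (K + K)%N.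
have p0 : (X ^+ N) 0%N = 0 by rewrite fpsXn0 //; lia.
have term0 (n : int) : (K <= `|n|)%N -> eqm K (jterm R N i n) 0.
  by apply: eqm_jterm; lia.
exists [seq j%:Z - L%:Z | j <- iota 0 (L + L).+1]; split.
- by rewrite map_inj_uniq ?iota_uniq // => a b; lia.
- move=> n nN; apply: term0; rewrite leqNgt; apply: contra nN => lt_nK.
  by apply/mapP; exists (absz (n + L%:Z)); rewrite ?mem_iota /L; lia.
rewrite big_map -[iota _ _]/(index_iota 0 (L + L).+1) big_mkord.
apply: eqm_sym.
apply: (@eqm_trans _ _ (qpoch_inf (X ^+ N) (X ^+ N) *
  (qpoch (X ^+ i) (X ^+ N) L * qpoch (X ^+ (N - i)) (X ^+ N) L))).
  apply: eqmM; first exact: eqm_refl.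
  by apply: eqmM; apply: qpoch_inf_eqm; rewrite // /L leq_addr.
rewrite jacobi_triple_fin // mulr_sumr; apply: eqm_sum => j _.
rewrite mulrCA [_ * qbinom _ _ _]mulrC -[X in eqm _ _ X]mulr1.
(* With L = 2K, an index either is large enough for the term to vanish or has a q-binomial
   coefficient at distance K from both ends of its row. *)
have [le_K | lt_K] := leqP K `|j%:Z - L%:Z|.
  apply: (@eqm_trans _ _ 0); last apply: eqm_sym.
    by rewrite -(mul0r (qbinom (X ^+ N) (L + L) j * qpoch_inf (X ^+ N) (X ^+ N)));
       apply: eqmM; [exact: term0 | exact: eqm_refl].
  by rewrite -(mul0r 1); apply: eqmM; [exact: term0 | exact: eqm_refl].
apply: eqmM; first exact: eqm_refl.
by apply: qbinom_central_eqm => //; have := leq_ord j; rewrite /L in lt_K *; lia.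
Qed.

(** The triple product for modulus 3m and residue m: its three symbols are the classes m, 2m and 3m
    of (X^m; X^m)_oo. *)
Lemma pentagonal m : (0 < m)%N ->
  hassum (jterm R (m * 3)%N m) (qpoch_inf (X ^+ m) (X ^+ m)).
Proof.
move=> m0; have := @jacobi_triple (m * 3) m; rewrite (_ : (0 < m < m * 3)%N); last by lia.
move=> /(_ isT); rewrite (@qpoch_inf_dissect _ m 3) // !big_ord_recl big_ord0 /=.
rewrite (_ : m * 3 - m = m * 2)%N; last by lia.
by rewrite muln1 mulr1 mulrC mulrA.
Qed.
End ThetaSums.

(** * The A2 Macdonald identity *)

Definition alpha (N : int) (x : int * int) : fps int :=
  (chi3 (x.1 - x.2))%:~R * fpsX int ^+ `|expo N x.1 x.2|.

Lemma fps_int_opp_eq0 (f : fps int) : f = - f -> f = 0.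
Proof.
move=> fN; apply/fpsP => n; have /(_ n) := (fpsP f (- f)).1 fN.
by rewrite fpsNE fps0E; move: (f n) => z; lia.
Qed.

Lemma absz_add (z a b : int) : 0 <= a -> 0 <= b -> a + b = z -> (`|a| + `|b|)%N = `|z|%N.
Proof. lia. Qed.

Lemma wt_ge0 (x y : int) : chi3 (x - y) != 0 -> 0 <= wt x y.
Proof.
have H (w s : int) : 3 * w + 1 = s -> 0 <= s -> 0 <= w by lia.
move=> /wtE w3; apply: H w3 _; nia.
Qed.

Lemma expo_ge0 (N x y : int) : 2 <= N -> chi3 (x - y) != 0 -> 0 <= expo N x y.
Proof.
move=> N2 c0; have := expo2_ge0 c0; have w0 := wt_ge0 c0.
have -> : expo N x y = expo 2 x y + (N - 2) * wt x y by rewrite /expo; ring.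
by move=> e2; rewrite addr_ge0 // mulr_ge0 // subr_ge0.
Qed.

(** The indices (n1, n2, n3) = (1 - x - t, 1 - x - y - t, t) run through the line on which n1 + n3 =
    1 - x and n2 + n3 = 1 - x - y. *)
Lemma jterm3 (x y t : int) (E : int := jexp 11 1 (1 - x - t) + jexp 11 1 (1 - x - y - t) + jexp 11 2 t) :
  0 <= E /\ jterm int 11 1 (1 - x - t) * jterm int 11 1 (1 - x - y - t) * jterm int 11 2 t
    = (-1) ^+ `|(2 * x + y + t)%R| * fpsX int ^+ `|E|.
Proof.
have ge0 (i n : int) : 0 < i -> i < 11 -> 0 <= jexp 11 i n.
  by move=> i0 i11; apply: le_trans (jexp_ge n i0 i11); rewrite normr_ge0.
have := ge0 1 (1 - x - t) isT isT; have := ge0 1 (1 - x - y - t) isT isT.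
have := ge0 2 t isT isT; rewrite /E => e1 e2 e3; split; first by rewrite addr_ge0 // addr_ge0.
rewrite /jterm.
rewrite -(gez0_abs e1) -(gez0_abs e2) -(gez0_abs e3) -!PoszD !absz_nat.
have -> : (-1) ^+ `|(2 * x + y + t)%R|
    = (-1) ^+ `|(1 - x - t)%R| * (-1) ^+ `|(1 - x - y - t)%R| * (-1) ^+ `|t| :> fps int.
  rewrite -!exprD -signr_odd -[RHS]signr_odd; congr (_ ^+ nat_of_bool _); lia.
rewrite !exprD; ring.
Qed.

(** The linear parts add up to 2 - 2x - y, free of t, because the residues satisfy 1 + 1 = 2. *)
Lemma jterm3_2E (x y t : int) :
  2 * (jexp 11 1 (1 - x - t) + jexp 11 1 (1 - x - y - t) + jexp 11 2 t)
  = 11 * ((1 - x - t) * (- x - t) + (1 - x - y - t) * (- x - y - t) + t * (t - 1))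
    + 2 * (2 - 2 * x - y).
Proof.
rewrite /jexp; transitivity (11 * (2 * tri (1 - x - t) + 2 * tri (1 - x - y - t) + 2 * tri t)
  + 2 * (2 - 2 * x - y)); first by ring.
by rewrite !triE; ring.
Qed.

(* With 2 - 2x - y = 3m + k, the substitution t = m + tau turns the sum into the
   pentagonal number series if k = 0 or k = 1; if k = 2 the terms of tau and
   1 - tau cancel. *)
Lemma hassum_line (x y : int) :
  hassum (fun t => jterm int 11 1 (1 - x - t) * jterm int 11 1 (1 - x - y - t) * jterm int 11 2 t)
    (alpha 11 (x, y) * qpoch_inf (fpsX int ^+ 11) (fpsX int ^+ 11)).
Proof.
have pent := @pentagonal int 11 isT.
have pentE (n : int) : 2 * jexp 33 11 n = 33 * (n * (n - 1)) + 22 * n.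
  by rewrite /jexp mulrDr mulrCA triE; ring.
have pent0 (n : int) : 0 <= jexp 33 11 n.
  by apply: le_trans (jexp_ge n _ _) => //; rewrite normr_ge0.
have [m Em] : exists m : int, [\/ 2 - 2 * x - y = 3 * m, 2 - 2 * x - y = 3 * m + 1
    | 2 - 2 * x - y = 3 * m + 2].
  exists ((2 - 2 * x - y) %/ 3)%Z; have := divz_eq (2 - 2 * x - y) 3.
  have := ltz_pmod (2 - 2 * x - y) (isT : (0 : int) < 3).
  have := modz_ge0 (2 - 2 * x - y) (isT : (3 : int) != 0).
  move: (_ %/ _)%Z (_ %% _)%Z => a r r0 r3 E.
  have : r = 0 \/ r = 1 \/ r = 2 by lia.
  by case=> [|[]] Er; [apply: Or31 | apply: Or32 | apply: Or33]; lia.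
have E2 t := jterm3_2E x y t.
case: Em => Em.
- have chiE : chi3 (x - y) = 1 by rewrite (@chi3_shift 1 _ (x + m - 1)) //; lia.
  have w3 : 3 * wt x y + 1 = x ^+ 2 + x * y + y ^+ 2 by apply: wtE; rewrite chiE.
  have e0 : 0 <= expo 11 x y by apply: expo_ge0; rewrite ?chiE.
  apply: (@eq_hassum _ _ (fun t => alpha 11 (x, y) * jterm int 33 11 (m - t))).
    move=> t; have [E0 ->] := jterm3 x y t; rewrite /alpha /jterm /= chiE mul1r.
    have -> : (-1) ^+ `|(2 * x + y + t)%R| = (-1) ^+ `|(m - t)%R| :> fps int.
      rewrite -signr_odd -[RHS]signr_odd; congr (_ ^+ nat_of_bool _); lia.
    rewrite mulrCA -exprD; congr (_ * _ ^+ _); apply: absz_add => //.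
    (* The factor 6 clears the denominators 2 of [tri] and 3 of [wt]. *)
    apply: (@mulfI _ (6 : int)) => //.
    transitivity (22 * (3 * wt x y + 1) - 22 + 6 * (2 - 2 * x - y) + 3 * (2 * jexp 33 11 (m - t))).
      by rewrite /expo; ring.
    transitivity (3 * (2 * (jexp 11 1 (1 - x - t) + jexp 11 1 (1 - x - y - t) + jexp 11 2 t))); last by ring.
    by rewrite w3 pentE E2 (_ : y = 2 - 2 * x - 3 * m); [ring | lia].
  by apply: hassumM; apply: (@hassum_reindex _ _ _ (fun t => m - t) (fun t => m - t)) pent => t;
    lia.
- have chiE : chi3 (x - y) = -1 by rewrite (@chi3_shift 2 _ (x + m - 1)) //; lia.
  have w3 : 3 * wt x y + 1 = x ^+ 2 + x * y + y ^+ 2 by apply: wtE; rewrite chiE.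
  have e0 : 0 <= expo 11 x y by apply: expo_ge0; rewrite ?chiE.
  apply: (@eq_hassum _ _ (fun t => alpha 11 (x, y) * jterm int 33 11 (t - m))).
    move=> t; have [E0 ->] := jterm3 x y t; rewrite /alpha /jterm /= chiE.
    have -> : (-1) ^+ `|(2 * x + y + t)%R| = - (-1) ^+ `|(t - m)%R| :> fps int.
      rewrite -[RHS]mulN1r -exprS -signr_odd -[RHS]signr_odd.
      congr (_ ^+ nat_of_bool _); lia.
    rewrite rmorphN1 mulN1r !mulNr mulrCA -exprD; congr (- (_ * _ ^+ _)).
    apply: absz_add => //; apply: (@mulfI _ (6 : int)) => //.
    transitivity (22 * (3 * wt x y + 1) - 22 + 6 * (2 - 2 * x - y) + 3 * (2 * jexp 33 11 (t - m))).
      by rewrite /expo; ring.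
    transitivity (3 * (2 * (jexp 11 1 (1 - x - t) + jexp 11 1 (1 - x - y - t) + jexp 11 2 t))); last by ring.
    by rewrite w3 pentE E2 (_ : y = 2 - 2 * x - (3 * m + 1)); [ring | lia].
  by apply: hassumM; apply: (@hassum_reindex _ _ _ (fun t => t - m) (fun t => t + m)) pent => t;
    lia.
have chiE : chi3 (x - y) = 0 by rewrite (@chi3_shift 0 _ (x + m)) //; lia.
rewrite /alpha /= chiE !mul0r.
apply: (@hassum_anti _ _ _ (fun t => 2 * m + 1 - t) fps_int_opp_eq0).
- move=> K; exists [seq j%:Z - K%:Z | j <- iota 0 (K + K).+1] => t tN.
  have {tN} le_Kt : (K <= `|t|)%N.
    rewrite leqNgt; apply: contra tN => lt_tK; apply/mapP;
    exists (absz (t + K%:Z)); rewrite ?mem_iota; lia.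
  have [E0 ->] := jterm3 x y t; rewrite mulrC; apply: eqm_Xn0.
  apply: leq_trans le_Kt _.
  have := jexp_ge (1 - x - t) (isT : (0 : int) < 1) (isT : (1 : int) < 11).
  have := jexp_ge (1 - x - y - t) (isT : (0 : int) < 1) (isT : (1 : int) < 11).
  have := jexp_ge t (isT : (0 : int) < 2) (isT : (2 : int) < 11).
  move: E0; move: (jexp _ _ _) (jexp _ _ _) (jexp _ _ _) => a b c; lia.
- by move=> t; lia.
move=> t; have [_ ->] := jterm3 x y t; have [_ ->] := jterm3 x y (2 * m + 1 - t).
have -> : (-1) ^+ `|(2 * x + y + (2 * m + 1 - t))%R| = - (-1) ^+ `|(2 * x + y + t)%R| :> fps int.
  rewrite -[RHS]mulN1r -exprS -signr_odd -[RHS]signr_odd.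
  congr (_ ^+ nat_of_bool _); lia.
rewrite mulNr; congr (- (_ * _ ^+ absz _)); apply: (@mulfI _ (2 : int)) => //.
by rewrite !jterm3_2E (_ : y = 2 - 2 * x - (3 * m + 2)); [ring | lia].
Qed.

Local Notation X := (fpsX int).
Local Notation th i := (qpoch_inf (X ^+ i) (X ^+ 11) * qpoch_inf (X ^+ (11 - i)) (X ^+ 11)).

Lemma hassum_alpha : hassum (alpha 11) (qpoch_inf (X ^+ 11) (X ^+ 11) ^+ 2 * (th 1 ^+ 2 * th 2)).
Proof.
have regroup (P a b : fps int) : P * (P ^+ 2 * (a ^+ 2 * b)) = P * a * (P * a) * (P * b).
  by ring.
have j1 := @jacobi_triple int 11 1 isT; have j2 := @jacobi_triple int 11 2 isT.
have j3 := hassum_mul (hassum_mul j1 j1) j2.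
(* [h] sends (x, y, t) to the three summation indices; being invertible over the integers, it
   partitions Z^3 into lines. *)
pose h (z : int * int * int) := ((1 - z.1.1 - z.2, 1 - z.1.1 - z.1.2 - z.2), z.2).
pose h' (z : int * int * int) := ((1 - z.1.1 - z.2, z.1.1 - z.1.2), z.2).
have j4 := @hassum_reindex _ _ _ h h' _ _ _ _ j3.
have qpoch_infX_unit : qpoch_inf (X ^+ 11) (X ^+ 11) \is a GRing.unit.
  by apply: qpoch_inf_unit; rewrite fpsXn0.
have {}j4 := hassum_fubini (j4 _ _) (fun xy : int * int => hassum_line xy.1 xy.2).
have {}j4 : hassum (fun xy => qpoch_inf (X ^+ 11) (X ^+ 11) * alpha 11 xy)
    (qpoch_inf (X ^+ 11) (X ^+ 11) * (qpoch_inf (X ^+ 11) (X ^+ 11) ^+ 2 * (th 1 ^+ 2 * th 2))).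
  apply: eq_hassum (_ : hassum (fun xy : int * int => alpha 11 (xy.1, xy.2) * qpoch_inf (X ^+ 11) (X ^+ 11)) _).
    by case=> x y; rewrite mulrC.
  rewrite regroup.
  apply: j4.
  + by case=> -[x y] t; rewrite /h /h' /=; congr (_, _, _); lia.
  + by case=> -[x y] t; rewrite /h /h' /=; congr (_, _, _); lia.
have := hassumM (qpoch_inf (X ^+ 11) (X ^+ 11))^-1 j4; rewrite mulKr //.
by apply: eq_hassum => xy; rewrite mulKr.
Qed.

(** * The Bailey chain *)

Section BaileyWeights.
Variables (R : comUnitRingType) (q : R).
Hypothesis qfact_unit : forall n, qfact q n \is a GRing.unit.

Local Notation Q n := (qfact q n)^-1.

(* 1 / (q)_z, which vanishes when z < 0. *)
Definition qfactVz (z : int) : R := if z is Posz n then Q n else 0.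

Lemma qfactVzE z n : z = n%:Z -> qfactVz z = Q n.
Proof. by move=> ->. Qed.

Lemma qfactVz_lt0 z : z < 0 -> qfactVz z = 0.
Proof. by case: z. Qed.

(* f_{r,s}(mu) for mu = (x, y, - x - y). *)
Definition bailey_wt (r s : nat) (x y : int) : R :=
  qfact q (r + s) * (qfactVz (r%:Z - x) * qfactVz (r%:Z - y) * qfactVz (r%:Z + x + y))
  * (qfactVz (s%:Z + x) * qfactVz (s%:Z + y) * qfactVz (s%:Z - x - y)).

Lemma bailey_wtC r s x y : bailey_wt r s y x = bailey_wt r s x y.
Proof. by rewrite /bailey_wt -!addrA [y + x]addrC [- y - x]addrC; ring. Qed.

Lemma bailey_wt_cyc r s x y : bailey_wt r s x (- x - y) = bailey_wt r s x y.
Proof.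
rewrite /bailey_wt (_ : r%:Z - (- x - y) = r%:Z + x + y); last by lia.
rewrite (_ : r%:Z + x + (- x - y) = r%:Z - y); last by lia.
rewrite (_ : s%:Z + (- x - y) = s%:Z - x - y); last by lia.
rewrite (_ : s%:Z - x - (- x - y) = s%:Z + y); last by lia.
ring.
Qed.

Lemma sum_ord_shift m k (f : nat -> R) : (forall i, (i < m)%N -> f i = 0) ->
  \sum_(i < (m + k).+1) f i = \sum_(i < k.+1) f (m + i)%N.
Proof.
move=> f0; rewrite -addnS big_split_ord /= big1 ?add0r // => i _.
exact: f0.
Qed.

Lemma bailey_wt_dom r s x y m d e n : x = m%:Z -> x - y = d%:Z -> x + 2 * y = e%:Z ->
  x + y = n%:Z -> bailey_wt (m + r) (n + s) x y = bailey_dom q r s d e.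
Proof.
move=> xm xyd xye xyn; rewrite /bailey_wt /bailey_dom.
rewrite (@qfactVzE ((m + r)%N%:Z - x) r); last by lia.
rewrite (@qfactVzE ((m + r)%N%:Z - y) (r + d)); last by lia.
rewrite (@qfactVzE ((m + r)%N%:Z + x + y) (r + d + e)); last by lia.
rewrite (@qfactVzE ((n + s)%N%:Z + x) (s + d + e)); last by lia.
rewrite (@qfactVzE ((n + s)%N%:Z + y) (s + e)); last by lia.
rewrite (@qfactVzE ((n + s)%N%:Z - x - y) s); last by lia.
rewrite (_ : m + r + (n + s) = r + s + d + e)%N; last by lia.
ring.
Qed.

(** The exponent on the right is |mu|^2/2. *)
Definition bailey_at (A B : nat) (x y : int) : Prop :=
  \sum_(r < A.+1) \sum_(s < B.+1) q ^+ (r ^ 2 + s ^ 2 - r * s)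
    * Q (A - r) * Q (B - s) * bailey_wt r s x y
  = q ^+ `|x ^+ 2 + x * y + y ^+ 2| * bailey_wt A B x y.

(** For a dominant weight the summands vanish unless r >= x and s >= x + y; shifting r and s by
    these bounds yields [bailey_lemma_dom]. *)
Lemma bailey_dominant A B (x y : int) : y <= x -> - x - y <= y -> bailey_at A B x y.
Proof.
move=> le_yx le_zy; rewrite /bailey_at.
have [m xm] : exists m : nat, x = m%:Z by exists (absz x); lia.
have [d xyd] : exists d : nat, x - y = d%:Z by exists (absz (x - y)); lia.
have [e xye] : exists e : nat, x + 2 * y = e%:Z by exists (absz (x + 2 * y)); lia.
have [n xyn] : exists n : nat, x + y = n%:Z by exists (absz (x + y)); lia.
have wf0l r s : (r < m)%N -> bailey_wt r s x y = 0.
  by move=> lt_rm; rewrite /bailey_wt (@qfactVz_lt0 (_ - x)) ?(mul0r, mulr0) //; lia.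
have wf0r r s : (s < n)%N -> bailey_wt r s x y = 0.
  by move=> lt_sn; rewrite /bailey_wt (@qfactVz_lt0 (_ - x - y)) ?(mul0r, mulr0) //; lia.
have [lt_Am | le_mA] := ltnP A m.
  rewrite wf0l // mulr0 big1 // => r _; rewrite big1 // => s _.
  by rewrite wf0l ?mulr0 // (leq_ltn_trans _ lt_Am) // leq_ord.
have [lt_Bn | le_nB] := ltnP B n.
  rewrite wf0r // mulr0 big1 // => r _; rewrite big1 // => s _.
  by rewrite wf0r ?mulr0 // (leq_ltn_trans _ lt_Bn) // leq_ord.
move: le_mA le_nB => /subnKC <- /subnKC <-; move: (A - m)%N (B - n)%N => {A B} A B.
rewrite (sum_ord_shift _ (f := fun r => \sum_(s < (n + B).+1) q ^+ (r ^ 2 + s ^ 2 - r * s)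
    * Q (m + A - r) * Q (n + B - s) * bailey_wt r s x y)); last first.
  by move=> r lt_rm; rewrite big1 // => s _; rewrite wf0l ?mulr0.
rewrite (bailey_wt_dom _ _ xm xyd xye xyn).
rewrite -(bailey_lemma_dom qfact_unit) mulr_sumr; apply: eq_bigr => r _.
rewrite (sum_ord_shift _ (f := fun s => q ^+ ((m + r) ^ 2 + s ^ 2 - (m + r) * s)
    * Q (m + A - (m + r)) * Q (n + B - s) * bailey_wt (m + r) s x y)); last first.
  by move=> s lt_sn; rewrite wf0r ?mulr0.
rewrite mulr_sumr; apply: eq_bigr => s _.
rewrite (bailey_wt_dom _ _ xm xyd xye xyn) !subnDl.
pose E0 := (r ^ 2 + s ^ 2 - r * s + r * d + s * e)%N.
transitivity (q ^+ (`|x ^+ 2 + x * y + y ^+ 2| + E0)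
  * Q (A - r) * Q (B - s) * bailey_dom q r s d e); last by rewrite exprD -!mulrA.
congr (q ^+ _ * _ * _ * _); rewrite /E0.
have rsE (a b : nat) : (a * b <= a ^ 2 + b ^ 2)%N by rewrite -!mulnn; nia.
have rsZ (a b : nat) : (a ^ 2 + b ^ 2 - a * b)%N%:Z = a%:Z ^+ 2 + b%:Z ^+ 2 - a%:Z * b%:Z.
  by rewrite -subzn // PoszD PoszM -!mulnn !PoszM.
apply/eqP; rewrite -eqz_nat; apply/eqP.
rewrite !PoszD !rsZ gez0_abs; last by nia.
rewrite !PoszD !PoszM xm -xyd -xye -xyn xm; ring.
Qed.

(** Both sides are invariant under permutations of the coordinates of mu, and sorting makes mu
    dominant. *)
Lemma bailey_lemma A B (x y : int) : bailey_at A B x y.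
Proof.
have swap (a b : int) : bailey_at A B a b -> bailey_at A B b a.
  rewrite /bailey_at bailey_wtC => E; under eq_bigr do under eq_bigr do rewrite bailey_wtC.
  by rewrite E; congr (q ^+ absz _ * _); ring.
have cyc (a b : int) : bailey_at A B a b -> bailey_at A B a (- a - b).
  rewrite /bailey_at bailey_wt_cyc => E; under eq_bigr do under eq_bigr do rewrite bailey_wt_cyc.
  by rewrite E; congr (q ^+ absz _ * _); ring.
have cyc2 (a b : int) : - a - (- a - b) = b by lia.
have P (a b : int) : b <= a -> bailey_at A B a b.
  move=> le_ba; have [le_cb | lt_bc] := lerP (- a - b) b; first exact: bailey_dominant.
  rewrite -(cyc2 a b); apply: cyc.
  have [le_ca | lt_ac] := lerP (- a - b) a; first by apply: bailey_dominant; lia.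
  by apply: swap; apply: bailey_dominant; lia.
by have [/P // | lt_xy] := lerP y x; apply/swap/P/ltW.
Qed.

End BaileyWeights.

Section BaileyChain.
Local Notation X := (fpsX int).
Local Notation Q n := (qfact X n)^-1.
Local Notation iq := (qfactV_sub X).

Lemma qfactX_unit n : qfact X n \is a GRing.unit.
Proof. exact: fps_qfact_unit. Qed.

Definition irange (B : nat) : seq int := [seq j%:Z - B%:Z | j <- iota 0 (B + B).+1].

Definition box (B : nat) : seq (int * int) := [seq (x, y) | x <- irange B, y <- irange B].

Lemma irange_uniq B : uniq (irange B).
Proof. by rewrite map_inj_uniq ?iota_uniq // => a b; lia. Qed.

Lemma mem_irange B z : (z \in irange B) = (`|z| <= B)%N.
Proof.
apply/mapP/idP => [[j] | le_zB]; first by rewrite mem_iota => j_lt ->; lia.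
by exists (absz (z + B%:Z)); rewrite ?mem_iota; lia.
Qed.

Lemma box_uniq B : uniq (box B).
Proof. by apply: allpairs_uniq; rewrite ?irange_uniq // => -[? ?] [? ?]. Qed.

Lemma mem_box B x : (x \in box B) = (`|x.1| <= B)%N && (`|x.2| <= B)%N.
Proof.
case: x => a b; rewrite -!mem_irange; apply/allpairsP/andP => [[[c d] [/= ? ? [-> ->]]] //|[? ?]].
by exists (a, b).
Qed.

Lemma sum_seq_widen (I : eqType) (V : nmodType) (F : I -> V) (r t : seq I) :
  uniq r -> uniq t -> {subset r <= t} -> (forall i, i \notin r -> F i = 0) ->
  \sum_(i <- r) F i = \sum_(i <- t) F i.
Proof.
move=> ur ut rt F0; rewrite [RHS](bigID (mem r)) /= [X in _ + X]big1 ?addr0 => [|i /F0 //].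
rewrite -[RHS]big_filter; apply: perm_big; apply: uniq_perm; rewrite ?filter_uniq // => i.
by rewrite mem_filter; case ir: (i \in r) => //=; rewrite rt.
Qed.

Lemma sum_irange (V : nmodType) (B r s : nat) (g : int -> V) : (r <= B)%N -> (s <= B)%N ->
  (forall z : int, (r%:Z < z) || (z < - s%:Z) -> g z = 0) ->
  \sum_(z <- irange B) g z = \sum_(i < (r + s).+1) g (r%:Z - i%:Z).
Proof.
move=> rB sB g0; pose t := [seq r%:Z - i%:Z | i <- iota 0 (r + s).+1].
rewrite -(@sum_seq_widen _ _ g t) ?irange_uniq //.
- by rewrite big_map -[iota _ _]/(index_iota 0 (r + s).+1) big_mkord.
- by rewrite map_inj_uniq ?iota_uniq // => a b; lia.
- by move=> z /mapP[i]; rewrite mem_iota mem_irange => i_lt ->; lia.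
move=> z zN; apply: g0; apply: contraNT zN => z_in.
by apply/mapP; exists (absz (r%:Z - z)); rewrite ?mem_iota; lia.
Qed.

(** For r, s <= B the weight [bailey_wt] vanishes outside [box B], so this is the sum over the whole
    lattice. *)
Definition beta (N : int) (B r s : nat) : fps int :=
  \sum_(x <- box B) alpha N x * bailey_wt X r s x.1 x.2.

Lemma bailey_wt_out r s (x y : int) :
  [|| r%:Z < x, r%:Z < y, x < - s%:Z, y < - s%:Z, x + y < - r%:Z | s%:Z < x + y] ->
  bailey_wt X r s x y = 0.
Proof.
move=> H; have : [\/ r%:Z - x < 0, r%:Z - y < 0 | [\/ s%:Z + x < 0, s%:Z + y < 0
    | r%:Z + x + y < 0 \/ s%:Z - x - y < 0]].
  case/or4P: H => [H|H|H|/or3P[H|H|H]]; [apply: Or31|apply: Or32|..]; try lia;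
  apply: Or33; [apply: Or31|apply: Or32|apply: Or33; left|apply: Or33; right]; lia.
rewrite /bailey_wt; by case=> [H1|H1|[H1|H1|[H1|H1]]]; rewrite (qfactVz_lt0 X H1) ?(mul0r, mulr0).
Qed.

(** The Bailey lemma contributes |mu|^2/2 = 3 [wt] + 1, whereas raising N by 3 accounts for 3 [wt]
    only. The surplus 1 comes from replacing r, s by r + 1, s + 1 in r^2 - r s + s^2. *)
Lemma expo_step (N x y : int) : 2 <= N -> chi3 (x - y) != 0 ->
  `|expo (N + 3) x y|.+1 = (`|expo N x y| + `|(x ^+ 2 + x * y + y ^+ 2)%R|)%N.
Proof.
move=> N2 c0; have e1 := expo_ge0 N2 c0.
have e2 : 0 <= expo (N + 3) x y by apply: expo_ge0 => //; lia.
have := wt_ge0 c0; rewrite -(wtE c0).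
have : expo (N + 3) x y = expo N x y + 3 * wt x y by rewrite /expo; ring.
by move: e1 e2; move: (expo _ _ _) (expo _ _ _) (wt _ _) => a b c; lia.
Qed.

Lemma beta_step (N : int) (B A C : nat) : 2 <= N ->
  \sum_(r < A.+1) \sum_(s < C.+1) X ^+ (r ^ 2 + s ^ 2 - r * s + r + s)
    * Q (A - r) * Q (C - s) * beta N B r.+1 s.+1 = beta (N + 3) B A.+1 C.+1.
Proof.
move=> N2.
transitivity (\sum_(x <- box B) \sum_(r < A.+1) \sum_(s < C.+1)
    X ^+ (r ^ 2 + s ^ 2 - r * s + r + s) * Q (A - r) * Q (C - s) *
    (alpha N x * bailey_wt X r.+1 s.+1 x.1 x.2)).
  rewrite [RHS]exchange_big; apply: eq_bigr => r _.
  rewrite [RHS]exchange_big; apply: eq_bigr => s _.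
  by rewrite mulr_sumr.
apply: eq_bigr => -[x y] _ /=; rewrite /alpha /=.
have [-> | c0] := eqVneq (chi3 (x - y)) 0.
  rewrite (_ : 0%:~R = 0 :> fps int) // [X in _ = X * _]mul0r [RHS]mul0r.
  apply: big1 => r _; apply: big1 => s _.
  by rewrite mul0r mul0r mulr0.
(* [chi3] excludes mu = 0, and for other mu the terms with r = 0 or s = 0 vanish, so the sums may
   start at 1. *)
have xy0 : (x != 0) || (y != 0).
  by apply: contraNT c0; rewrite negb_or !negbK => /andP[/eqP-> /eqP->].
have wf0l s : bailey_wt X 0 s x y = 0 by apply: bailey_wt_out; lia.
have wf0r r : bailey_wt X r 0 x y = 0 by apply: bailey_wt_out; lia.
apply: (@fpsX_lreg _ 1); rewrite expr1.
have E : \sum_(r < A.+1) \sum_(s < C.+1) X ^+ (r.+1 ^ 2 + s.+1 ^ 2 - r.+1 * s.+1)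
    * Q (A - r) * Q (C - s) * bailey_wt X r.+1 s.+1 x y
    = X ^+ `|(x ^+ 2 + x * y + y ^+ 2)%R| * bailey_wt X A.+1 C.+1 x y.
  rewrite -(bailey_lemma qfactX_unit A.+1 C.+1 x y) [RHS]big_ord_recl.
  rewrite [X in _ = X + _]big1 => [|s _]; last by rewrite wf0l mulr0.
  rewrite add0r; apply: eq_bigr => r _; rewrite [RHS]big_ord_recl.
  rewrite [X in _ = X + _](_ : _ = 0); last by rewrite wf0r mulr0.
  by rewrite add0r; apply: eq_bigr => s _; rewrite !subSS.
transitivity ((chi3 (x - y))%:~R * X ^+ `|expo N x y|
  * (X ^+ `|(x ^+ 2 + x * y + y ^+ 2)%R| * bailey_wt X A.+1 C.+1 x y)); last first.
  have : X * X ^+ `|expo (N + 3) x y| = X ^+ `|expo N x y| * X ^+ `|(x ^+ 2 + x * y + y ^+ 2)%R|.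
    by rewrite -exprS expo_step // exprD.
  set a := X ^+ `|expo (N + 3) x y|; set b := X ^+ `|expo N x y|.
  set c := X ^+ `|_|; move: (bailey_wt _ _ _ _ _) (_%:~R : fps int) => w ch Eabc.
  transitivity (ch * (b * c) * w); first by ring.
  by rewrite -Eabc; ring.
rewrite -E !mulr_sumr; apply: eq_bigr => r _.
rewrite !mulr_sumr; apply: eq_bigr => s _.
have -> : (r.+1 ^ 2 + s.+1 ^ 2 - r.+1 * s.+1 = (r ^ 2 + s ^ 2 - r * s + r + s).+1)%N.
  have rs : (r * s <= r ^ 2 + s ^ 2)%N by rewrite -!mulnn; nia.
  by rewrite -!mulnn in rs *; nia.
rewrite exprS; move: (bailey_wt _ _ _ _ _) (_%:~R : fps int) => w ch; ring.
Qed.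

End BaileyChain.

(** * The start of the chain *)

Section Seed2.
Local Notation X := (fpsX int).
Local Notation Q n := (qfact X n)^-1.

Lemma qbinom_qfactVz M (i : nat) : (i <= M)%N ->
  qbinom X M i = qfact X M * (qfactVz X i%:Z * qfactVz X (M%:Z - i%:Z)).
Proof.
move=> le_iM; rewrite subzn //= -{1 2}(subnKC le_iM).
by rewrite (qbinomE qfactX_unit) mulrA.
Qed.

Lemma sum_qbinom_eq M (z : int) :
  \sum_(k < M.+1) (if k%:Z == z then qbinom X M k else 0)
  = qfact X M * (qfactVz X z * qfactVz X (M%:Z - z)).
Proof.
case: (boolP ((0 <= z) && (z <= M%:Z))) => [/andP[]|zN].
  case: z => // m _; rewrite lez_nat => le_mM.
  have lt_mM : (m < M.+1)%N by [].
  rewrite (bigD1 (Ordinal lt_mM)) //= eqxx big1 ?addr0 ?qbinom_qfactVz // => k.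
  by rewrite -val_eqE /= => /negbTE km; rewrite eqz_nat km.
rewrite big1 => [|k _]; last by case: eqP => // kz; have := leq_ord k; lia.
have [z0 | z0] := ltrP z 0; first by rewrite qfactVz_lt0 // mul0r mulr0.
by rewrite (@qfactVz_lt0 _ _ (M%:Z - z)) ?mulr0 //; lia.
Qed.

(** Multiplied by (q)_M^2 with M = a + b + 2, each weight becomes a product of three q-binomials,
    and the sum becomes [seed_sum]. *)
Lemma beta_seed (a b B : nat) : (a < B)%N -> (b < B)%N ->
  beta 2 B a.+1 b.+1 = X ^+ (2 * (a * b)) * (Q a * Q b * Q (a + b).+1).
Proof.
move=> aB bB; pose M := (a + b).+2.
have MU : qfact X M \is a GRing.unit by exact: qfactX_unit.
apply: (mulrI MU); apply: (mulrI MU).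
transitivity (seed_sum X a M); last first.
  rewrite seed_sumE (qbinomE qfactX_unit); symmetry.
  have E1 : qfact X M * Q (a + b).+1 = 1 - X ^+ (a + b).+2.
    by rewrite /M qfactS mulrC mulKr // qfactX_unit.
  have E2 : qfact X M = qfact X (a + b) * (1 - X ^+ (a + b).+1) * (1 - X ^+ (a + b).+2).
    by rewrite /M 2!qfactS.
  transitivity (X ^+ (2 * (a * b)) * (Q a * Q b) * qfact X M * (qfact X M * Q (a + b).+1)).
    by ring.
  by rewrite E1 E2; ring.
rewrite /beta /box big_allpairs /=.
rewrite (@sum_irange _ B a.+1 b.+1) //; last first.
  by move=> z zN; rewrite big1 // => y _; rewrite bailey_wt_out ?mulr0 //=; lia.
rewrite addnS addSn /seed_sum !mulr_sumr; apply: eq_bigr => i _.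
rewrite (@sum_irange _ B a.+1 b.+1) //; last first.
  by move=> z zN; rewrite bailey_wt_out ?mulr0 //=; lia.
rewrite addnS addSn !mulr_sumr; apply: eq_bigr => j _.
have iM := leq_ord i; have jM := leq_ord j.
(* The sum over k has at most one nonzero term, fixed by i + j + k = 3(a + 1). *)
set x := a.+1%:Z - i%:Z; set y := a.+1%:Z - j%:Z.
transitivity (alpha 2 (x, y) * qbinom X M i * qbinom X M j
   * \sum_(k < M.+1) (if k%:Z == a.+1%:Z + x + y then qbinom X M k else 0)).
  rewrite sum_qbinom_eq !qbinom_qfactVz // /bailey_wt.
  rewrite (_ : a.+1%:Z - x = i%:Z); last by rewrite /x; lia.
  rewrite (_ : a.+1%:Z - y = j%:Z); last by rewrite /y; lia.
  rewrite (_ : b.+1%:Z + x = M%:Z - i%:Z); last by rewrite /x /M; lia.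
  rewrite (_ : b.+1%:Z + y = M%:Z - j%:Z); last by rewrite /y /M; lia.
  rewrite (_ : b.+1%:Z - x - y = M%:Z - (a.+1%:Z + x + y)); last by rewrite /x /y /M; lia.
  rewrite (_ : a.+1 + b.+1 = M)%N; last by rewrite /M; lia.
  move: (alpha _ _) (qfactVz _ _) (qfactVz _ _) (qfactVz _ _) (qfactVz _ _)
     (qfactVz _ _) (qfactVz _ _) (qfact X M).
  by move=> *; ring.
rewrite mulr_sumr; apply: eq_bigr => k _; rewrite /alpha /=.
rewrite (_ : x - y = j%:Z - i%:Z); last by rewrite /x /y; lia.
rewrite (_ : (k%:Z == a.+1%:Z + x + y) = (i + j + k == 3 * a.+1)%N); last by rewrite /x /y; lia.
by case: eqP => _; rewrite ?mulr0.
Qed.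

End Seed2.

(** * Iteration of the chain and its limit *)

Section Limit.
Local Notation X := (fpsX int).
Local Notation Q n := (qfact X n)^-1.
Local Notation iq := (qfactV_sub X).
Local Notation P := (qpoch_inf X X).

Definition pairs L : seq (nat * nat) := [seq (r, s) | r <- iota 0 L.+1, s <- iota 0 L.+1].

Lemma mem_pairs L p : (p \in pairs L) = (p.1 <= L)%N && (p.2 <= L)%N.
Proof.
case: p => r s; apply/allpairsP/andP => [[[a b]]|[rL sL]].
  by rewrite !mem_iota => -[a_lt b_lt [-> ->]].
by exists (r, s); rewrite !mem_iota.
Qed.

Lemma pairs_uniq L : uniq (pairs L).
Proof. by apply: allpairs_uniq; rewrite ?iota_uniq // => -[? ?] [? ?]. Qed.

Lemma sum_pairs L (f : nat * nat -> fps int) :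
  \sum_(p <- pairs L) f p = \sum_(r < L.+1) \sum_(s < L.+1) f (nat_of_ord r, nat_of_ord s).
Proof.
rewrite big_allpairs -[iota _ _]/(index_iota 0 L.+1) big_mkord.
by apply: eq_bigr => r _; rewrite big_mkord.
Qed.

Definition pexp (p : nat * nat) := (p.1 ^ 2 + p.2 ^ 2 - p.1 * p.2 + p.1 + p.2)%N.

Definition iq2 (p p' : nat * nat) : fps int := iq p.1 p'.1 * iq p.2 p'.2.

Lemma beta_rec (N : int) (B L : nat) p : 2 <= N -> p \in pairs L ->
  beta (N + 3) B p.1.+1 p.2.+1
  = \sum_(p' <- pairs L) X ^+ pexp p' * iq2 p p' * beta N B p'.1.+1 p'.2.+1.
Proof.
case: p => A C N2; rewrite mem_pairs sum_pairs => /= /andP[AL CL].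
rewrite -beta_step //.
rewrite (eq_bigr (fun r : 'I_L.+1 => iq A r * \sum_(s < L.+1) iq C s *
    (X ^+ pexp (nat_of_ord r, nat_of_ord s) * beta N B r.+1 s.+1))); last first.
  by move=> r _; rewrite mulr_sumr; apply: eq_bigr => s _; rewrite /iq2 /=; ring.
rewrite (sum_iq_widen _ (fun r => \sum_(s < L.+1) iq C s *
    (X ^+ pexp (r, nat_of_ord s) * beta N B r.+1 s.+1))) //.
apply: eq_bigr => r _.
rewrite (sum_iq_widen _ (fun s => X ^+ pexp (nat_of_ord r, s) * beta N B r.+1 s.+1)) //.
rewrite mulr_sumr; apply: eq_bigr => s _.
by rewrite /iq /= (leq_ord r) (leq_ord s) /pexp /=; ring.
Qed.

(* The summand of the triple sum, indexed by (r1, s1), (r2, s2), (r3, s3) and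
   extended by 0 to all sextuples. *)
Definition term (x : (nat * nat) * ((nat * nat) * (nat * nat))) : fps int :=
  X ^+ (pexp x.1 + pexp x.2.1 + pexp x.2.2 + 2 * (x.2.2.1 * x.2.2.2))
  * (iq2 x.1 x.2.1 * iq2 x.2.1 x.2.2
     * (Q x.2.2.1 * Q x.2.2.2 * Q (x.2.2.1 + x.2.2.2).+1)).

Definition pairs3 L := [seq (p1, p23) | p1 <- pairs L,
  p23 <- [seq (p2, p3) | p2 <- pairs L, p3 <- pairs L]].

Lemma pairs3_uniq L : uniq (pairs3 L).
Proof.
apply: allpairs_uniq => [||[a b] [c d] _ _ /= [-> ->] //]; first exact: pairs_uniq.
by apply: allpairs_uniq; rewrite ?pairs_uniq // => -[? ?] [? ?].
Qed.

Lemma mem_pairs3 L x : (x \in pairs3 L)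
  = [&& x.1 \in pairs L, x.2.1 \in pairs L & x.2.2 \in pairs L].
Proof.
case: x => p1 [p2 p3]; apply/allpairsP/and3P => [[[a bc] [ha hbc [-> E]]]|[h1 h2 h3]].
  by case/allpairsP: hbc => -[d e] [hd he E']; case: (etrans E E') => -> ->.
by exists (p1, (p2, p3)); split=> //; apply/allpairsP; exists (p2, p3).
Qed.

(** Three steps raise N from 11 - 9 = 2, where [beta_seed] applies, through 5 and 8 to 11. *)
Lemma beta11_sum L : beta 11 L.+1 L.+1 L.+1
  = \sum_(x <- pairs3 L) iq2 (L, L) x.1 * term x.
Proof.
have LL : (L, L) \in pairs L by rewrite mem_pairs leqnn.
rewrite (@beta_rec 8 _ L (L, L)) // [RHS]big_allpairs; apply: eq_big_seq => p1 h1.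
rewrite (@beta_rec 5 _ L p1) // [RHS]big_allpairs mulr_sumr; apply: eq_big_seq => p2 h2.
rewrite (@beta_rec 2 _ L p2) // !mulr_sumr; apply: eq_big_seq => p3.
rewrite mem_pairs => /andP[r3 s3]; rewrite beta_seed // /term !exprD.
rewrite -[(p1, (p2, p3)).1]/p1 -[(p1, (p2, p3)).2.1]/p2 -[(p1, (p2, p3)).2.2]/p3.
move: (iq2 _ _) (iq2 _ _) (iq2 _ _) => a b c; ring.
Qed.

Lemma pexp_ge p : (p.1 + p.2 <= pexp p)%N.
Proof. by rewrite /pexp -addnA leq_addl. Qed.

Lemma term_eqm0 K x : x \notin pairs3 K.-1 -> eqm K (term x) 0.
Proof.
case: x => [[r1 s1] [[r2 s2] [r3 s3]]]; rewrite mem_pairs3 !mem_pairs /= => H.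
apply: eqm_Xn0 => /=.
have := pexp_ge (r1, s1); have := pexp_ge (r2, s2); have := pexp_ge (r3, s3) => /=.
by move: (pexp _) (pexp _) (pexp _) => a b c; lia.
Qed.

Lemma qfactX_eqm K n : (K <= n)%N -> eqm K (qfact X n) P.
Proof. by move=> le_Kn; apply/eqm_sym/qfact_eqm. Qed.

Lemma qpoch_infX_unit : P \is a GRing.unit.
Proof. exact: qpoch_inf_unit. Qed.

Lemma qfactV_eqm K n : (K <= n)%N -> eqm K (Q n) P^-1.
Proof. by move=> le_Kn; apply: eqmV; [exact: qfactX_unit | exact: qpoch_infX_unit | exact: qfactX_eqm]. Qed.

(** As L grows in [beta11_sum], the outer factor [iq2] tends to (q)_oo^-2 and [bailey_wt] to
    (q)_oo^(1-6). Their ratio is (q)_oo^-3. *)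
Lemma hassum_term S : hassum (alpha 11) S -> hassum term (P ^- 3 * S).
Proof.
move=> aS K; have [s0 [us0 a0 _]] := aS K.
have [M hM] : exists M : nat, {in s0, forall x, (`|x.1| <= M)%N && (`|x.2| <= M)%N}.
  elim: s0 {us0 a0} => [|x s0 [M hM]]; first by exists 0%N.
  exists (M + (`|x.1| + `|x.2|))%N => y; rewrite inE => /predU1P[->|/hM /andP[y1 y2]].
    by apply/andP; split; rewrite addnCA; [exact: leq_addr | by rewrite addnA leq_addl].
  by apply/andP; split; apply: leq_trans (leq_addr _ _).
(* The margin 2M absorbs x, y and x + y for every weight in [s0], so all factorial indices stay at
   least K. *)
pose L := (K + K + M + M)%N; exists (pairs3 L); split; first exact: pairs3_uniq.
  move=> x xN; apply: term_eqm0; apply: contra xN; rewrite !mem_pairs3 !mem_pairs /L; lia.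
have step1 : eqm K (\sum_(x <- pairs3 L) term x) (qfact X L * qfact X L * beta 11 L.+1 L.+1 L.+1).
  rewrite beta11_sum mulr_sumr; apply: eqm_sum => x _; rewrite mulrA.
  have [xK | xK] := boolP (x \in pairs3 K.-1); last first.
    apply: (@eqm_trans _ _ 0); first exact: term_eqm0.
    apply: eqm_sym; rewrite -(mulr0 (qfact X L * qfact X L * iq2 (L, L) x.1)).
    by apply: eqmM; [exact: eqm_refl | exact: term_eqm0].
  rewrite -[X in eqm _ X _]mul1r; apply: eqmM; last exact: eqm_refl.
  move: xK; rewrite mem_pairs3 => /andP[]; case: x.1 => r1 s1; rewrite mem_pairs => /andP[r1K s1K] _.
  have -> : 1 = P * P * (P^-1 * P^-1) by rewrite mulrACA divrr ?mulr1 // qpoch_infX_unit.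
  have LK : (K <= L)%N by rewrite /L; lia.
  have iqP a : (a <= K.-1)%N -> eqm K P^-1 (iq L a).
    move=> aK; rewrite /iq (_ : (a <= L)%N); last by rewrite /L; lia.
    by apply/eqm_sym/qfactV_eqm; rewrite /L; lia.
  by do 2!apply: eqmM; try exact: iqP; apply/eqm_sym/qfactX_eqm.
apply: (eqm_trans step1); rewrite /beta mulr_sumr.
apply: (@eqm_trans _ _ (\sum_(x <- box L.+1) P ^- 3 * alpha 11 x)); last first.
  rewrite -mulr_sumr; apply: eqmM; first exact: eqm_refl.
  apply: hassum_seq aS (box_uniq _) _ => x xN; apply: a0; apply: contra xN => /hM/andP[x1 x2].
  have ML : (M <= L.+1)%N by rewrite /L; lia.
  by rewrite mem_box (leq_trans x1 ML) (leq_trans x2 ML).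
apply: eqm_sum => x _.
have [xs | /a0 x0] := boolP (x \in s0); last first.
  apply: (@eqm_trans _ _ 0); last apply: eqm_sym.
    rewrite mulrCA -(mul0r (qfact X L * qfact X L * bailey_wt X L.+1 L.+1 x.1 x.2)).
    by apply: eqmM; [exact: x0 | exact: eqm_refl].
  by rewrite -(mulr0 (P ^- 3)); apply: eqmM; [exact: eqm_refl | exact: x0].
rewrite [alpha _ _ * _]mulrC mulrA; apply: eqmM; last exact: eqm_refl.
have -> : P ^- 3 = P * P * (P * (P^-1 * P^-1 * P^-1) * (P^-1 * P^-1 * P^-1)).
  have PV := divrr qpoch_infX_unit; rewrite -exprVn; move: PV; move: P^-1 => V PV.
  transitivity (((P * V) * (P * V) * (P * V)) * V ^+ 3); last by ring.
  by rewrite PV !mul1r.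
have VP (z : int) : K%:Z <= z -> eqm K (qfactVz X z) P^-1.
  by case: z => // n; rewrite lez_nat => /qfactV_eqm.
have /andP[x1 x2] := hM _ xs; rewrite /bailey_wt.
have qP n : (K <= n)%N -> eqm K (qfact X n) P by exact: qfactX_eqm.
do !apply: eqmM; first [apply: VP | apply: qP]; move: x1 x2; rewrite /L;
  move: (x.1) (x.2) => a b; lia.
Qed.
End Limit.

(** * The stated sum and the theta quotient *)

Local Open Scope classical_set_scope.

Lemma hassum_fps_sum (R : comUnitRingType) (I : choiceType) (D : set I) (F G : I -> fps R) S :
  (forall i, D i -> F i = G i) -> (forall i, ~ D i -> G i = 0) -> hassum G S ->
  fps_summable D F /\ fps_sum D F = S.
Proof.
move=> FG G0 GS; split=> [n|].
  have [s [_ G0' _]] := GS n.+1; apply: sub_finite_set (finite_seq s) => i /= [Di Fi].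
  apply: contraNT Fi => /G0'/(_ n (ltnSn n)); by rewrite FG // => ->.
apply/fpsP => n; have [s [us G0' GsS]] := GS n.+1.
rewrite -(GsS n) //= (@eq_fsbigr _ _ _ _ (fun i => F i n) (fun i => G i n)); last first.
  by move=> i /set_mem Di; rewrite FG.
rewrite (fsbig_widen D setT (fun i => G i n)) //; last by move=> i [_ Di] /=; rewrite G0.
transitivity (\sum_(i <- s) G i n); last first.
  by elim: s {us G0' GsS} => [|i s IHs]; rewrite ?big_nil // !big_cons IHs.
rewrite (fsbig_seq _ (fun i => G i n) us) (fsbig_widen [set` s] setT (fun i => G i n)) // => i [_ /= /negP is_].
by apply: (G0' i).
Qed.

(** The point is p^2 t1^2 t2 W = P^2. *)
Lemma theta_quotient (R : comUnitRingType) (P p t1 t2 t3 t4 t5 : R)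
  (W := t2 * (t3 * (t3 * (t4 * (t4 * (t5 * (t5 * 1))))))) :
  P \is a GRing.unit -> W \is a GRing.unit -> P = p * t1 * t2 * t3 * t4 * t5 ->
  P ^- 3 * (p ^+ 2 * (t1 ^+ 2 * t2)) = 1 / P * (1 / W).
Proof.
move=> P_unit W_unit PE; apply: (mulIr W_unit).
rewrite -[RHS]mulrA divrK // mulr1 mul1r -exprVn; have := divrr P_unit; move: (P^-1) => V PV.
transitivity (V * (P * V) * (P * V)); last by rewrite PV !mulr1.
rewrite /W PE; ring.
Qed.

Theorem theorem1p8 :
  let q := fpsX int in
  let D : set ((nat * nat * nat) * (nat * nat * nat)) :=
    [set x | let: ((r1, r2, r3), (s1, s2, s3)) := x in
       [/\ (r1 >= r2)%N, (r2 >= r3)%N, (s1 >= s2)%N & (s2 >= s3)%N]] in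
  let F (x : (nat * nat * nat) * (nat * nat * nat)) : fps int :=
    let: ((r1, r2, r3), (s1, s2, s3)) := x in
    (* r ^ 2 + s ^ 2 - r * s does not truncate, as r * s <= r ^ 2 + s ^ 2 *)
    q ^+ ((r1 ^ 2 + s1 ^ 2 - r1 * s1) + (r2 ^ 2 + s2 ^ 2 - r2 * s2)
          + (r3 ^ 2 + r3 * s3 + s3 ^ 2)
          + (r1 + r2 + r3 + s1 + s2 + s3))%N
    / (qpoch q q (r1 - r2) * qpoch q q (r2 - r3) * qpoch q q r3
       * qpoch q q (s1 - s2) * qpoch q q (s2 - s3) * qpoch q q s3
       * qpoch q q (r3 + s3 + 1)) in
  fps_summable D F /\
  fps_sum D F =
    1 / qpoch_inf q q
    * (1 / thetas [:: q ^+ 2; q ^+ 3; q ^+ 3; q ^+ 4; q ^+ 4; q ^+ 5; q ^+ 5]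
                  (q ^+ 11)).
Proof.
move=> q D F.
pose h (x : (nat * nat * nat) * (nat * nat * nat)) :=
  ((x.1.1.1, x.2.1.1), ((x.1.1.2, x.2.1.2), (x.1.2, x.2.2))).
pose h' (y : (nat * nat) * ((nat * nat) * (nat * nat))) :=
  ((y.1.1, y.2.1.1, y.2.2.1), (y.1.2, y.2.1.2, y.2.2.2)).
have hK : cancel h h' by case=> -[[r1 r2] r3] [[s1 s2] s3].
have h'K : cancel h' h by case=> -[r1 s1] [[r2 s2] [r3 s3]].
have := hassum_reindex hK h'K (hassum_term hassum_alpha).
set S := (X in hassum _ X); have -> : S = 1 / qpoch_inf q q
    * (1 / thetas [:: q ^+ 2; q ^+ 3; q ^+ 3; q ^+ 4; q ^+ 4; q ^+ 5; q ^+ 5] (q ^+ 11)).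
  pose th i := qpoch_inf (q ^+ i) (q ^+ 11) * qpoch_inf (q ^+ (11 - i)) (q ^+ 11).
  have thE i : (i <= 11)%N -> theta (q ^+ i) (q ^+ 11) = th i by exact: theta_Xn.
  have th_unit i : (0 < i < 11)%N -> th i \is a GRing.unit.
    by move=> i_lt; rewrite unitrM !qpoch_inf_unit // fpsXn0 //; lia.
  (* Dissection of (q)_oo modulo 11, the classes i and 11 - i being paired. *)
  have PE : qpoch_inf q q = qpoch_inf (q ^+ 11) (q ^+ 11) * th 1 * th 2 * th 3 * th 4 * th 5.
    have := @qpoch_inf_dissect int 1 11 isT isT; rewrite expr1 => ->.
    under eq_bigr => i _ do rewrite !mul1n.
    have key (f : nat -> fps int) : \prod_(i < 11) f i.+1
        = f 11 * (f 1 * f 10) * (f 2 * f 9) * (f 3 * f 8) * (f 4 * f 7) * (f 5 * f 6).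
      by rewrite !big_ord_recl big_ord0 /=; ring.
    exact: (key (fun i => qpoch_inf (q ^+ i) (q ^+ 11))).
  have TE : thetas [:: q ^+ 2; q ^+ 3; q ^+ 3; q ^+ 4; q ^+ 4; q ^+ 5; q ^+ 5] (q ^+ 11)
      = th 2 * (th 3 * (th 3 * (th 4 * (th 4 * (th 5 * (th 5 * 1)))))).
    by rewrite /thetas 7!big_cons big_nil (thE 2 isT) (thE 3 isT) (thE 4 isT) (thE 5 isT).
  have W_unit : th 2 * (th 3 * (th 3 * (th 4 * (th 4 * (th 5 * (th 5 * 1)))))) \is a GRing.unit.
    by do 7![apply: rpredM; first exact: th_unit]; exact: unitr1.
  by rewrite TE; apply: theta_quotient qpoch_infX_unit W_unit PE.
apply: hassum_fps_sum => -[[[r1 r2] r3] [[s1 s2] s3]].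
  case=> r12 r23 s12 s23; rewrite /F /= /term /h /iq2 /= /qfactV_sub r12 r23 s12 s23 !qpochE.
  rewrite -/q; congr (_ * _).
    (* The exponent 2 r3 s3 of the initial identity turns - r3 s3 into + r3 s3. *)
    congr (_ ^+ _); have : (r3 * s3 <= r3 ^ 2 + s3 ^ 2)%N by rewrite -!mulnn; nia.
    rewrite /pexp /=; move: (r1 ^ 2 + s1 ^ 2 - r1 * s1)%N (r2 ^ 2 + s2 ^ 2 - r2 * s2)%N => a b.
    by move: (r3 ^ 2)%N (s3 ^ 2)%N (r3 * s3)%N => c d e; lia.
  by rewrite !invrM ?unitrM ?qfactX_unit // addn1; ring.
(* Outside [D] one of the four reciprocal factorials of a difference is 0 by convention. *)
move=> nD; rewrite /= /term /iq2 /qfactV_sub /=.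
have : ~~ [&& r2 <= r1, r3 <= r2, s2 <= s1 & s3 <= s2]%N.
  by apply: contra_notN nD => /and4P.
rewrite !negb_and => /or4P[] /negbTE ->; by rewrite ?(mul0r, mulr0).
Qed.
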